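(* Let $M=\overline I$ (with $I\subset\mathbf R$ a bounded open interval) or $M=\mathbf T=\mathbf R/\mathbf Z$. Let $F:\mathbf R\to\mathbf R$ be continuous and nonnegative, with $F(v)=0$ if and only if $v=1$, and suppose there are positive constants $c_0,c_1$ with $F(v)\ge c_0|v|^2-c_1$ for all $v\in\mathbf R$. Let $\varepsilon_j>0$ with $\varepsilon_j\to0$ as $j\to\infty$, let $\{v_{\varepsilon_j}\}_{j=1}^\infty\subset H^1(M)\subset C(M)$, and assume $$\sup_jE^{\varepsilon_j}_{\mathrm{sMM}}(v_{\varepsilon_j})<\infty.$$ Then there exists a subsequence $\{v_{\varepsilon'_k}\}$ such that $v_{\varepsilon'_k}\xrightarrow{g}\Xi$ for some $\Xi\in\mathcal A_0$.
   Context: Elements of $H^1(M)$ are identified with their continuous representatives. For $\varepsilon>0$, $$E^{\varepsilon}_{\mathrm{sMM}}(v)=\frac{\varepsilon}{2}\int_M\left|\frac{dv}{dx}\right|^2dx+\frac1{2\varepsilon}\int_MF(v)\,dx.$$ A set-valued function $\Gamma$ on $M$ assigns to each $x\in M$ a compact set $\Gamma(x)\subset\mathbf R$; $\operatorname{graph}\Gamma=\{(x,y)\in M\times\mathbf R: y\in\Gamma(x)\}$. $\mathcal B$ is the set of all $\Gamma$ such that $\operatorname{graph}\Gamma$ is compact, with metric $d_g(\Gamma_1,\Gamma_2)=d_H(\operatorname{graph}\Gamma_1,\operatorname{graph}\Gamma_2)$, where $d_H$ is the Hausdorff distance on $M\times\mathbf R$ (product metric $(d_M(z_1,w_1)^2+|z_2-w_2|^2)^{1/2}$).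 A function $v\in C(M)$ is identified with $\Gamma_v$, $\Gamma_v(x)=\{v(x)\}$, and $v_k\xrightarrow{g}\Xi$ means $d_g(\Gamma_{v_k},\Xi)\to0$ (graph convergence). $\mathcal A_0$ is the set of $\Xi\in\mathcal B$ such that $\Xi(x)$ is a closed interval (possibly a point) for every $x\in M$ and there is an at most countable (possibly finite) set $\Sigma=\{x_i\}\subset M$ with $\Xi(x)=\{1\}$ for $x\notin\Sigma$ and $\Xi(x_i)=[\xi_i^-,\xi_i^+]$, $\xi_i^-<\xi_i^+$, $\xi_i^-\le1\le\xi_i^+$, for $x_i\in\Sigma$. *)

(* Defs.v *)
From HB Require Import structures.
From mathcomp Require Import all_boot all_order all_algebra.
From mathcomp Require Import all_classical all_reals all_analysis.
From mathcomp Require Import ring lra.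

Set Implicit Arguments.
Unset Strict Implicit.
Unset Printing Implicit Defensive.

Import Order.TTheory GRing.Theory Num.Theory.
Import numFieldNormedType.Exports.

Local Open Scope classical_set_scope.
Local Open Scope ring_scope.

Section Torus.
Variable R : realType.

Definition int_equiv (x y : R) : bool := x - y \is a Num.int.

Lemma int_equiv_refl : reflexive int_equiv.
Proof. by move=> x; rewrite /int_equiv subrr rpred0. Qed.

Lemma int_equiv_sym : symmetric int_equiv.
Proof. by move=> x y; rewrite /int_equiv -opprB rpredN. Qed.

Lemma int_equiv_trans : transitive int_equiv.
Proof. by move=> y x z xy yz; rewrite /int_equiv -(subrKA y) rpredD. Qed.

Canonical int_equiv_rel :=
  EquivRel int_equiv int_equiv_refl int_equiv_sym int_equiv_trans.

Local Open Scope quotient_scope.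

Definition torus : Type := {eq_quot int_equiv}.
HB.instance Definition _ := Choice.on torus.
HB.instance Definition _ := EqQuotient.on torus.

Definition torus_pi (t : R) : torus := \pi_torus t.

Lemma torus_piP s t : reflect (torus_pi s = torus_pi t) (s - t \is a Num.int).
Proof. by apply: (iffP idP) => [st|/eqP]; [apply/eqP|]; rewrite eqmodE. Qed.

Lemma torus_pi_surj x : exists t, torus_pi t = x.
Proof. by exists (repr x); rewrite /torus_pi reprK. Qed.

Definition torus_dists (x y : torus) : set R :=
  [set `|s - t| | s in torus_pi @^-1` [set x] & t in torus_pi @^-1` [set y]].

Definition torus_dist (x y : torus) : R := inf (torus_dists x y).

Lemma torus_dists_neq0 x y : torus_dists x y !=set0.
Proof.
have [[s sx] [t ty]] := (torus_pi_surj x, torus_pi_surj y).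
by exists `|s - t|, s => //; exists t.
Qed.

Lemma torus_dists_lb x y : lbound (torus_dists x y) 0.
Proof. by move=> _ [s _ [t _ <-]]; exact: normr_ge0. Qed.

Lemma torus_dists_has_inf x y : has_inf (torus_dists x y).
Proof.
by split; [exact: torus_dists_neq0 | exists 0; exact: torus_dists_lb].
Qed.

Lemma torus_dist_ge0 x y : 0 <= torus_dist x y.
Proof.
by apply: lb_le_inf; [exact: torus_dists_neq0 | exact: torus_dists_lb].
Qed.

Lemma torus_dist_le s t : torus_dist (torus_pi s) (torus_pi t) <= `|s - t|.
Proof.
apply: ge_inf; first by exists 0; exact: torus_dists_lb.
by exists s => //; exists t.
Qed.

Lemma torus_distxx x : torus_dist x x = 0.
Proof.
have [t <-] := torus_pi_surj x.
apply/le_anti/andP; split; last exact: torus_dist_ge0.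
by rewrite (le_trans (torus_dist_le _ _))// subrr normr0.
Qed.

Lemma torus_distC x y : torus_dist x y = torus_dist y x.
Proof.
congr inf; apply/seteqP; split=> _ [s sx [t ty <-]];
  by exists t => //; exists s => //; rewrite distrC.
Qed.

Lemma torus_dist_triangle y x z :
  torus_dist x z <= torus_dist x y + torus_dist y z.
Proof.
apply/ler_addgt0Pl => e e0; have e20 : 0 < e / 2 by rewrite divr_gt0.
have [_ [s sx [t ty <-]] st] := inf_adherent e20 (torus_dists_has_inf x y).
have [_ [t' ty' [u uz <-]] tu] := inf_adherent e20 (torus_dists_has_inf y z).
have tt' : t - t' \is a Num.int by apply/torus_piP; rewrite ty ty'.
have uz' : torus_pi (u + (t - t')) = z.
  by rewrite -uz; apply/torus_piP; rewrite addrAC subrr add0r.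
have := torus_dist_le s (u + (t - t')); rewrite sx uz' => /le_trans; apply.
have -> : s - (u + (t - t')) = (s - t) + (t' - u).
  by ring.
rewrite (le_trans (ler_normD _ _))//.
rewrite -/(torus_dist x y) in st; rewrite -/(torus_dist y z) in tu.
lra.
Qed.

Lemma torus_dist_eq0 x y : torus_dist x y = 0 -> x = y.
Proof.
move=> xy0.
have [[s sx] [t ty]] := (torus_pi_surj x, torus_pi_surj y).
rewrite -sx -ty; apply/torus_piP; rewrite intrEfloor eq_sym.
set r := s - t; set f := Num.floor r.
have /andP[fl fu] : f%:~R <= r < (f + 1)%:~R.
  by rewrite Num.Theory.floor_le floorD1_gt.
rewrite eq_le fl andbT leNgt; apply/negP => fr.
pose e := Num.min (r - f%:~R) ((f + 1)%:~R - r).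
have e0 : 0 < e by rewrite lt_min !subr_gt0 fr fu.
have [_ [s' sx' [t' ty' <-]]] := inf_adherent e0 (torus_dists_has_inf x y).
rewrite -/(torus_dist x y) xy0 add0r ltNge => /negP; apply.
have : (s' - t') - r \is a Num.int.
  have -> : (s' - t') - r = (s' - s) + (t - t') by rewrite /r; ring.
  by rewrite rpredD//; apply/torus_piP; rewrite ?sx ?sx' ?ty ?ty'.
move=> /intrP[n /eqP]; rewrite subr_eq => /eqP ->.
have [nf|nf] := leP (- f) n.
  have {}nf : - f%:~R <= n%:~R :> R by rewrite -intrN ler_int.
  by rewrite ger0_norm /e ?ge_min; [apply/orP; left|]; lra.
have {}nf : n%:~R <= - (f + 1)%:~R :> R.
  by rewrite -intrN ler_int opprD -ltzD1 addrNK.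
by rewrite ler0_norm /e ?ge_min; [apply/orP; right|]; lra.
Qed.

HB.instance Definition _ := @isMetric.Build R torus torus_dist
  torus_distxx torus_dist_eq0 torus_distC torus_dist_triangle.

End Torus.

(* M is the closure of ]a, b[, or R/Z; it is presented as a subset [points M]
   of a metric space [ambient M], covered by a parameter t ranging over
   [params M] through [chart M]. Functions and set-valued functions on M are
   functions on [ambient M]; their values off [points M] play no role. *)
Inductive space1 (R : realType) :=
| ClosedInterval (a b : R) of a < b
| Torus.
Arguments Torus {R}.

Section Defs.
Variable R : realType.

Definition ambient (M : space1 R) : metricType R :=
  match M with
  | ClosedInterval _ _ _ => R^o
  | Torus => torus R
  end.

Definition points (M : space1 R) : set (ambient M) :=
  match M return set (ambient M) with
  | ClosedInterval a b _ => `[a, b]%classic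
  | Torus => setT
  end.
Arguments points : clear implicits.

Definition chart (M : space1 R) : R -> ambient M :=
  match M return R -> ambient M with
  | ClosedInterval _ _ _ => fun t => t
  | Torus => @torus_pi R
  end.

Definition params (M : space1 R) : set R :=
  match M with
  | ClosedInterval a b _ => `[a, b]%classic
  | Torus => `[0, 1]%classic
  end.

Definition continuous_on (M : space1 R) (v : ambient M -> R) : Prop :=
  {within points M, continuous v}.

Section Sobolev.
Variable M : space1 R.
Implicit Types v g phi : ambient M -> R.

Local Notation mu := (@lebesgue_measure R).

Definition dx phi : R -> R := derive1 (phi \o chart M).

Definition C1 phi : Prop :=
  (forall t, derivable (phi \o chart M) t 1) /\ continuous (dx phi).

Definition supported phi : Prop :=
  match M return (ambient M -> R) -> Prop with
  | ClosedInterval a b _ => fun phi : R -> R =>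
      closure [set t | phi t != 0] `<=` `]a, b[%classic
  | Torus => fun=> True
  end phi.

Definition L2 v : Prop :=
  measurable_fun (params M) (v \o chart M) /\
  (\int[mu]_(t in params M) (`|v (chart M t)| ^+ 2)%:E < +oo)%E.

(* The test functions are C^1 (not C^infinity) with compact support in the
   interior, as in Brezis, Functional Analysis, Sobolev Spaces and PDE, 8.2. *)
Definition is_weak_derivative v g : Prop :=
  L2 g /\
  forall phi, C1 phi -> supported phi ->
    \int[mu]_(t in params M) (v (chart M t) * dx phi t) =
    - \int[mu]_(t in params M) (g (chart M t) * phi (chart M t)).

(* Unique up to a.e. equality, hence integrals of it do not depend on the
   choice made by xget. *)
Definition weak_derivative v : ambient M -> R :=
  xget (cst 0) (is_weak_derivative v).

(* v is the continuous representative of its class. *)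
Definition H1 v : Prop :=
  [/\ continuous_on v, L2 v & exists g, is_weak_derivative v g].

Definition E_sMM (F : R -> R) (eps : R) v : \bar R :=
  ((eps / 2)%:E *
     \int[mu]_(t in params M) (`|weak_derivative v (chart M t)| ^+ 2)%:E +
   (2 * eps)^-1%:E * \int[mu]_(t in params M) (F (v (chart M t)))%:E)%E.

End Sobolev.

Section GraphConvergence.
Variable M : space1 R.
Implicit Types (Gamma Xi : ambient M -> set R) (z w : ambient M * R).

Definition graph Gamma : set (ambient M * R) :=
  [set z | points M z.1 /\ Gamma z.1 z.2].

Definition calB Gamma : Prop :=
  (forall x, points M x -> compact (Gamma x)) /\ compact (graph Gamma).

Definition dist2 z w : R :=
  Num.sqrt (mdist z.1 w.1 ^+ 2 + `|z.2 - w.2| ^+ 2).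

Definition excess (A B : set (ambient M * R)) : \bar R :=
  ereal_sup [set ereal_inf [set (dist2 z w)%:E | w in B] | z in A].

Definition d_H (A B : set (ambient M * R)) : \bar R :=
  Order.max (excess A B) (excess B A).

Definition d_g Gamma1 Gamma2 : \bar R := d_H (graph Gamma1) (graph Gamma2).

Definition singleton_fun (v : ambient M -> R) : ambient M -> set R :=
  fun x => [set v x].

Definition graph_cvg (v : nat -> ambient M -> R) Xi : Prop :=
  d_g (singleton_fun (v k)) Xi @[k --> \oo] --> 0%E.

Definition calA0 Xi : Prop :=
  [/\ calB Xi,
      (forall x, points M x -> exists l u : R, l <= u /\ Xi x = `[l, u]%classic) &
      exists Sigma : set (ambient M),
        [/\ Sigma `<=` points M, countable Sigma,
            (forall x, points M x -> ~ Sigma x -> Xi x = [set 1]) &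
            forall x, Sigma x -> exists xim xip : R,
              [/\ xim < xip, xim <= 1, 1 <= xip & Xi x = `[xim, xip]%classic]]].

End GraphConvergence.

End Defs.

Arguments points {R} M _.

(* Main.v *)
(* On a stretch [s, t] where F(v) >= m, Young's inequality bounds the energy
   from below by sqrt m * |v(t) - v(s)| as well as by m (t - s) / (2 eps); the
   only Sobolev input is |v(t) - v(s)| <= \int_s^t |v'|, obtained by testing
   against smoothed indicators of [s, t]. The second bound makes v_j close to 1
   somewhere in every fixed interval, for j large; the first one makes v_j
   uniformly bounded. By compactness the graphs then have a Hausdorff-convergent
   subsequence, and by the intermediate value theorem every fibre of the limit is
   an interval containing 1. A fibre different from {1} costs a fixed positive
   amount of energy in every neighbourhood of its base point, i.e. it gives a jump
   of the nondecreasing limit of the energies on [p, t], so there are at most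
   countably many of them. Everything happens in the parameter t; the chart is
   1-Lipschitz and carries the convergence over to M. *)
Require Import Defs.
From HB Require Import structures.
From mathcomp Require Import all_boot all_order all_algebra.
From mathcomp Require Import all_classical all_reals all_analysis.
From mathcomp Require Import measurable_realfun ring lra.

Import Order.TTheory GRing.Theory Num.Theory.
Import numFieldNormedType.Exports.

Local Open Scope classical_set_scope.
Local Open Scope ring_scope.

Set Implicit Arguments.
Unset Strict Implicit.
Unset Printing Implicit Defensive.

(** * Hausdorff-convergent subsequences *)

(** The rows [b j] are points of the Cantor space, which is compact, so they have a cluster point
    [x]. The index [sigma k] is chosen beyond the previous one so that its row agrees with [x] on
    the coordinates 0 to [k]; the constant for column [i] is then [x i]. *)
Lemma diagonal_extraction (b : nat -> nat -> bool) :
  exists sigma : nat -> nat,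
    (forall m n, (m < n)%N -> (sigma m < sigma n)%N) /\
    forall i, exists c, forall k, (i <= k)%N -> b (sigma k) i = c.
Proof.
have [x [_ xcl]] : [set: cantor_space] `&`
    cluster ((b : nat -> cantor_space) @ \oo) !=set0.
  by apply: cantor_space_compact; exact: filterT.
have step k N : exists j, (N <= j)%N /\ forall i, (i <= k)%N -> b j i = x i.
  have nx : nbhs x [set y : cantor_space | forall i, (i <= k)%N -> y i = x i].
    have H i : nbhs x [set y : cantor_space | y i = x i].
      have := @proj_continuous nat (fun=> bool) i x.
      by move=> /(_ [set x i]); apply; exact: discrete_set1.
    elim: k => [|k IH].
      by apply: filterS (H 0%N) => y y0 i; rewrite leqn0 => /eqP ->.
    near=> y => i; rewrite leq_eqVlt => /orP[/eqP ->|].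
      by near: y; exact: H.
    by rewrite ltnS; move: i; near: y; exact: IH.
  have nN : ((b : nat -> cantor_space) @ \oo) [set b j | j in [set j | (N <= j)%N]].
    by exists N => //= j Nj; exists j.
  have [_ [[j Nj <-] ji]] := xcl _ _ nN nx.
  by exists j.
have [f fP] : {f : nat -> nat -> nat | forall k N,
    (N <= f k N)%N /\ forall i, (i <= k)%N -> b (f k N) i = x i}.
  apply: constructive_indefinite_description.
  have /choice[f fP] : forall kN : nat * nat, exists j,
      (kN.2 <= j)%N /\ forall i, (i <= kN.1)%N -> b j i = x i.
    by move=> [k N]; exact: step.
  by exists (fun k N => f (k, N)) => k N; exact: fP (k, N).
pose sigma := fix sigma k := if k is k'.+1 then f k (sigma k').+1 else f 0%N 0%N.
exists sigma; split.
  apply: (@homo_ltn _ sigma (fun m n => (m < n)%N)) => [? ? ?|k];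
    first exact: ltn_trans.
  by have [] := fP k.+1 (sigma k).+1.
move=> i; exists (x i) => k ik.
by case: k ik => [|k] ik;
  [have [_ ->] := fP 0%N 0%N | have [_ ->] := fP k.+1 (sigma k).+1].
Unshelve. all: end_near. Qed.

Section kuratowski_limit.
Context {R : realType} {T : pseudoMetricType R}.
Implicit Types (G : nat -> set T).

(** This is the Kuratowski lower limit: every ball around the point meets all but finitely many of
    the sets. In the upper limit, infinitely many suffice. *)
Definition klim G : set T :=
  [set z | forall e, 0 < e -> \forall k \near \oo, G k `&` ball z e !=set0].

(** The family [c] acts as a countable basis. Along a diagonal subsequence each [c n] is, from some
    index on, either always met or never met, so the upper limit of the subsequence lies in its
    lower limit. *)
Lemma kuratowski_extraction (c : nat -> set T) G :
  (forall z e, 0 < e -> exists n d,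
    [/\ 0 < d, ball z d `<=` c n & c n `<=` ball z e]) ->
  exists sigma : nat -> nat,
    (forall m n, (m < n)%N -> (sigma m < sigma n)%N) /\
    forall z, (forall e N, 0 < e ->
      exists2 k, (N <= k)%N & G (sigma k) `&` ball z e !=set0) ->
      klim (G \o sigma) z.
Proof.
move=> cP; pose b j n := `[< G j `&` c n !=set0 >].
have [sigma [sigma_incr bsigma]] := diagonal_extraction b.
exists sigma; split => // z zG e e0.
have [n [d [d0 zdc cze]]] := cP z e e0.
have [B bB] := bsigma n.
(* Asking for an index beyond [n] lands in the range where the answer for [c n] is constant; a
   single meeting there forces that constant to be true. *)
have [k nk [w [Gw zw]]] := zG d n d0.
have Bt : B = true.
  by rewrite -(bB _ nk); apply/asboolP; exists w; split => //; exact: zdc.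
exists n => // m /= nm; have := bB _ nm; rewrite Bt => /asboolP[u [Gu cu]].
by exists u; split => //; exact: cze.
Qed.

Lemma closed_klim G : closed (klim G).
Proof.
move=> z zcl e e0.
have e20 : 0 < e / 2 by rewrite divr_gt0.
have [w [Gw zw]] := zcl _ (nbhsx_ballx z _ e20).
apply: filterS (Gw _ e20) => k [u [Gu wu]]; exists u; split => //.
by rewrite (splitr e); exact: ball_triangle zw wu.
Qed.

Lemma klim_sub G K : closed K -> (\forall k \near \oo, G k `<=` K) -> klim G `<=` K.
Proof.
move=> cK GK z Gz; apply: cK => B /nbhs_ballP[e /= e0 zeB].
have [k _ /(_ _ (leqnn k))[GkK [w [Gw zw]]]] := filterI GK (Gz e e0).
by exists w; split; [exact: GkK | exact: zeB].
Qed.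

(** Each point of the limit has its own threshold for [k]; compactness of the limit, covered by
    balls of half the radius, makes the threshold uniform. *)
Lemma klim_excess_r G K e : compact K -> klim G `<=` K -> 0 < e ->
  \forall k \near \oo, forall z, klim G z -> G k `&` ball z e !=set0.
Proof.
move=> cK GK e0; have e20 : 0 < e / 2 by rewrite divr_gt0.
have : compact (klim G).
  by apply: subclosed_compact GK => //; exact: closed_klim.
move=> /compact_near_coveringP /(_ _ \oo (fun k z => G k `&` ball z e !=set0) _); apply.
move=> z Gz; exists (ball z (e / 2), [set k | G k `&` ball z (e / 2) !=set0]).
  by split; [exact: nbhsx_ballx | exact: Gz].
move=> [w k] /= [zw [u [Gu zu]]]; exists u; split => //.
by rewrite (splitr e); apply: ball_triangle zu; exact: ball_sym.
Qed.

(** A point of [K] either lies in the limit, so that nearby points are within [e] of it, or lies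
    outside the upper limit and has a ball that all late [G k] miss. Compactness of [K] gives one
    index for all points. *)
Lemma klim_excess_l G K e : compact K -> (\forall k \near \oo, G k `<=` K) ->
  (forall z, (forall e N, 0 < e -> exists2 k, (N <= k)%N & G k `&` ball z e !=set0) ->
     klim G z) -> 0 < e ->
  \forall k \near \oo, forall z, G k z -> klim G `&` ball z e !=set0.
Proof.
move=> cK GK limsupG e0.
pose P k z := G k z -> klim G `&` ball z e !=set0.
have {}cK := (compact_near_coveringP K).1 cK.
have /cK : forall z, K z -> \forall z' \near z & k \near \oo, P k z'.
  move=> z Kz; have [Gz|nGz] := pselect (klim G z).
    exists (ball z e, setT) => /=; first by split; [exact: nbhsx_ballx|exact: filterT].
    by move=> [w k] /= [zw _] _; exists z; split => //; exact: ball_sym.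
  have [d [N [d0 dN]]] : exists d N, 0 < d /\ forall k, (N <= k)%N ->
    ~ (G k `&` ball z d !=set0).
    apply: contrapT => H; apply: nGz; apply: limsupG => d N d0.
    apply: contrapT => H'; apply: H; exists d, N; split => // k Nk Gk.
    by apply: H'; exists k.
  exists (ball z d, [set k | (N <= k)%N]) => /=.
    by split; [exact: nbhsx_ballx|exists N].
  by move=> [w k] /= [zw Nk] Gw; exfalso; apply: (dN _ Nk); exists w.
move=> H; near=> k => z Gz.
have Kz : K z by move: z Gz; near: k; exact: GK.
by move: z Kz Gz; near: k; exact: H.
Unshelve. all: end_near. Qed.

End kuratowski_limit.

(** The sets are the balls with rational centre and radius 1/(m+1), enumerated by [pickle]; an
    integer that codes nothing gets the empty set. *)
Lemma ratr_ball_basis (R : realType) : exists c : nat -> set (R * R),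
  forall z e, 0 < e -> exists n d, [/\ 0 < d, ball z d `<=` c n & c n `<=` ball z e].
Proof.
pose c n : set (R * R) := if unpickle n is Some abm
  then let: (a, b, m) := abm : rat * rat * nat in
    ball ((ratr a, ratr b) : (R * R)%type) m.+1%:R^-1
  else set0.
exists c => z e e0.
have [m me] : exists m, m.+1%:R^-1 < e / 2.
  have := @cvg_harmonic R => /cvgrPdist_lt /(_ _ (divr_gt0 e0 (ltr0Sn _ 1))).
  move=> [m _ /(_ m (leqnn m))]; rewrite sub0r normrN /= ger0_norm ?invr_ge0//.
  by exists m.
(* With a centre at distance less than [d] from [z] and radius 2d, the basic ball contains the
   [d]-ball around [z] and lies in the one of radius 3d, where 3d < e. *)
pose d : R := m.+1%:R^-1 / 2.
have d0 : 0 < d by rewrite divr_gt0.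
have rat_near (x : R) : exists a : rat, `|x - ratr a| < d.
  have [a] : exists a : rat, ratr a \in `](x - d), (x + d)[.
    have xd : x - d < x + d by rewrite ltrD2l gt0_cp.
    by have [a] := rat_in_itvoo xd; exists a.
  by rewrite in_itv/= => /andP[? ?]; exists a; rewrite ltr_distlC; apply/andP.
have [a za] := rat_near z.1; have [b zb] := rat_near z.2.
have cd : d + d = m.+1%:R^-1 by rewrite -splitr.
have zab : ball z d (ratr a, ratr b) by split; rewrite /ball/=.
exists (pickle ((a, b), m)), d; rewrite /c pickleK; split => // w zw.
  by rewrite -cd; apply: ball_triangle zw; exact: ball_sym.
apply: (@le_ball _ _ _ (d + m.+1%:R^-1)).
  by rewrite -cd in me *; lra.
exact: ball_triangle zab zw.
Qed.

(** * Jumps of monotone functions and level crossings of continuous ones *)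

Section real_functions.
Context {R : realType}.

(** The size [k] of the jump may depend on the point. Each jump leaves room for a rational between
    the values of [f] to the left and to the right, and the value of [f] halfway between two jump
    points separates their rationals. *)
Lemma nondecreasing_jumps_countable (f : R -> R) (S : set R) :
  {homo f : s t / s <= t} ->
  (forall t, S t -> exists2 k, 0 < k & forall s u, s < t -> t < u -> f s + k <= f u) ->
  countable S.
Proof.
move=> f_homo jump.
have rat_gap t : exists r : rat, S t ->
    (forall s, s < t -> f s < ratr r) /\ (forall u, t < u -> ratr r < f u).
  have [St|nSt] := pselect (S t); last by exists 0.
  have [k k0 kP] := jump t St.
  pose A := [set f s | s in [set s | s < t]].
  have supA : has_sup A.
    split; first by exists (f (t - 1)), (t - 1) => //=; rewrite ltrBlDr ltrDl.
    by exists (f t) => _ [s /= st <-]; apply: f_homo; exact: ltW.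
  have lt_supA : sup A < sup A + k by rewrite ltrDl.
  have [r] := rat_in_itvoo lt_supA; rewrite in_itv/= => /andP[Ar rA].
  exists r => _; split => [s st|u tu].
    apply: le_lt_trans Ar; apply: sup_upper_bound => //.
    by exists s.
  apply: (lt_le_trans rA); rewrite -lerBrDr.
  apply: ge_sup; first by case: supA.
  by move=> _ [s /= st <-]; rewrite lerBrDr; exact: kP.
have [r rP] := choice rat_gap.
apply/countable_injP; exists (fun t => pickle (r t)).
have mono s t : S s -> S t -> s < t -> r s <> r t.
  move=> Ss St st rst; pose u := (s + t) / 2.
  have [su ut] : s < u /\ u < t by rewrite /u; lra.
  have [_ /(_ _ su)] := rP _ Ss; have [/(_ _ ut) + _] := rP _ St.
  by rewrite rst => /lt_trans h /h; rewrite ltxx.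
move=> s t /set_mem Ss /set_mem St /(pcan_inj (@pickleK _)) rst.
by have [st|ts|//] := ltgtP s t; [case: (mono s t) | case: (mono t s)].
Qed.

(** The endpoints are written with min and max because the order of [x] and [y] is unknown where
    this is applied. *)
Lemma IVT_unordered (f : R -> R) (x y a : R) :
  {within `[Num.min x y, Num.max x y], continuous f} -> f x <= a -> a <= f y ->
  exists2 z, z \in `[Num.min x y, Num.max x y] & f z = a.
Proof.
move=> cf fxa afy; apply: IVT => //; first by rewrite ge_min !le_max !lexx.
by case: (leP x y) => _; rewrite ge_min le_max fxa afy ?orbT.
Qed.

Lemma subset_itv_minmax (u v p q : R) : u \in `[p, q] -> v \in `[p, q] ->
  {subset `[Num.min u v, Num.max u v] <= `[p, q]}.
Proof. by move=> + + z; rewrite !in_itv/=; case: (leP u v); lra. Qed.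

(** If [f] fell below [a] between [z] and [y], the intermediate value theorem would give a crossing
    closer to [y]. The sign on the whole stretch is what the energy inequalities require. *)
Lemma last_crossing (f : R -> R) (x y a : R) :
  {within `[Num.min x y, Num.max x y], continuous f} -> f x <= a -> a <= f y ->
  exists2 z, z \in `[Num.min x y, Num.max x y] &
    f z = a /\ forall u, u \in `[Num.min z y, Num.max z y] -> a <= f u.
Proof.
move=> cf fxa afy; set I := `[Num.min x y, Num.max x y] in cf *.
pose A := f @^-1` [set a] `&` [set` I].
have cA : compact A.
  apply: (@subclosed_compact _ _ [set` I]); last by move=> ? [].
    rewrite closed_setIS; last exact: interval_closed.
    apply: (@closed_comp (subspace [set` I]) R f [set a]);
      first by move=> ? _; exact: cf.
    exact: closed_eq.
  exact: segment_compact.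
have [z0 z0I fz0] := IVT_unordered cf fxa afy.
(* The crossing closest to [y] is the last one. *)
have cdist : {within A, continuous (fun z => `|z - y| : R)}.
  apply: continuous_subspaceT => z; apply: cvg_norm.
  by apply: cvgB; [exact: cvg_id | exact: cvg_cst].
have A0 : A !=set0 by exists z0.
have [z /set_mem [fz /= zI] zmin] := compact_EVT_min A0 cA cdist.
exists z => //; split => // u uzy; rewrite leNgt; apply/negP => fua.
have sub : {subset `[Num.min u y, Num.max u y] <= I}.
  move=> r; move: zI uzy; rewrite /I !in_itv/=.
  by case: (leP x y); case: (leP z y); case: (leP u y); lra.
have cfu : {within `[Num.min u y, Num.max u y], continuous f}.
  by apply: continuous_subspaceW cf => r; exact: sub.
have [z' z'uy fz'] := IVT_unordered cfu (ltW fua) afy.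
have /zmin : z' \in A by apply/mem_set; split => //; exact: sub.
have uz : u <> z by move=> uz; move: fua; rewrite uz fz ltxx.
have uz' : u <> z' by move=> uz'; move: fua; rewrite uz' fz' ltxx.
have {}uz : (u < z) || (z < u) by rewrite -neq_lt; apply/eqP.
have {}uz' : (u < z') || (z' < u) by rewrite -neq_lt; apply/eqP.
move: uzy z'uy uz uz'; rewrite !in_itv/= !ler_norml.
case: (leP z y); case: (leP u y); case: (ger0P (z - y)); case: (ger0P (z' - y)); lra.
Qed.

End real_functions.

(** * Limits of graphs of bounded energy *)

(** Coercivity gives F >= 1 for large |y|; on the remaining compact set away from 1, [F] attains a
    positive minimum. *)
Lemma well_lower_bound (R : realType) (F : R -> R) (c0 c1 d : R) :
  continuous F -> (forall y, 0 <= F y) -> (forall y, F y = 0 <-> y = 1) ->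
  0 < c0 -> 0 < c1 -> (forall y, c0 * `|y| ^+ 2 - c1 <= F y) -> 0 < d ->
  exists2 m, 0 < m & forall y, d <= `|y - 1| -> m <= F y.
Proof.
move=> cF F0 F1 c00 c10 Fc d0.
(* The choice gives c0 B - c1 = 1 + c0, and B > 1 turns |y| >= B into |y|^2 >= B. *)
pose B := 1 + (1 + c1) / c0.
have B1 : 1 < B by rewrite ltrDl divr_gt0// addr_gt0.
have Fbig y : B <= `|y| -> 1 <= F y.
  move=> By; apply: le_trans (Fc y).
  have : B <= `|y| ^+ 2.
    by rewrite (le_trans By)// expr2 ler_peMr// (le_trans (ltW B1)).
  rewrite -(ler_pM2l c00) /B mulrDr mulr1 [X in _ + X]mulrC divfK ?gt_eqF//; lra.
pose K := `[- B, B]%classic `&` [set y | d <= `|y - 1|].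
have cK : compact K.
  apply: (@subclosed_compact _ _ `[- B, B]%classic); last by move=> ? [].
    apply: closedI; first exact: interval_closed.
    apply: (@closed_comp _ _ (fun y : R => `|y - 1| : R) [set r | d <= r]);
      last exact: closed_ge.
    by move=> y _; apply: cvg_norm; apply: cvgB; [exact: cvg_id | exact: cvg_cst].
  exact: segment_compact.
(* For large [d] the set [K] may be empty; then every relevant [y] satisfies |y| > B and m = 1
   works. *)
have [K0|/set0P K0] := eqVneq K set0.
  exists 1 => // y dy; have [/Fbig//|yB] := leP B `|y|; exfalso.
  suff : K y by rewrite K0.
  by split => //=; rewrite in_itv/= -ler_norml ltW.
have [c /set_mem [_ /= dc] cmin] := compact_EVT_min K0 cK (continuous_subspaceT cF).
exists (Num.min 1 (F c)).
  rewrite lt_min ltr01 /= lt_neqAle F0 andbT eq_sym; apply/eqP => /F1 c1E.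
  by move: dc; rewrite c1E subrr normr0 leNgt d0.
move=> y dy; have [By|yB] := leP B `|y|; first by rewrite ge_min Fbig.
rewrite ge_min cmin ?orbT//; apply/mem_set; split => //=.
by rewrite in_itv/= -ler_norml ltW.
Qed.

Section energy_control.
Context {R : realType}.
Variables (p q : R) (F : R -> R).

(* [e t] plays the role of the Modica-Mortola energy of [w] on [p, t]. *)
Definition energy_control (eps C : R) (w e : R -> R) : Prop :=
  [/\ {within `[p, q], continuous w},
      {homo e : s t / s <= t}, forall t, 0 <= e t <= C,
      forall m s t, 0 < m -> p <= s -> s <= t -> t <= q ->
        (forall x, s <= x -> x <= t -> m <= F (w x)) ->
        Num.sqrt m * `|w t - w s| <= e t - e s &
      forall m s t, 0 < m -> p <= s -> s <= t -> t <= q ->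
        (forall x, s <= x -> x <= t -> m <= F (w x)) ->
        m * (t - s) <= 2 * eps * (e t - e s)].

(** After the last crossing of the level [a] by |w - 1| on the way from [x] to [y], F(w) stays above
    [m], so the first energy inequality applies there. Monotonicity of [e] passes from that stretch
    to [s, t]. *)
Lemma excursion_cost eps C w e (a m x y s t : R) : energy_control eps C w e ->
  0 < m -> (forall z, a <= `|z - 1| -> m <= F z) ->
  x \in `[p, q] -> y \in `[p, q] ->
  x \in `[s, t] -> y \in `[s, t] ->
  `|w x - 1| <= a -> a <= `|w y - 1| ->
  Num.sqrt m * (`|w y - 1| - a) <= e t - e s.
Proof.
move=> [cw e_homo _ cost _] m0 mF xpq ypq xst yst wx wy.
pose f z : R := `|w z - 1|.
have cf : {within `[Num.min x y, Num.max x y], continuous f}.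
  apply: (@continuous_subspaceW _ _ _ `[p, q]); first exact: subset_itv_minmax.
  move=> z; apply: (@cvg_norm _ R^o); apply: (@cvgB _ R^o);
    [exact: cw | exact: cvg_cst].
have [z zxy [fz fzy]] := last_crossing cf wx wy.
have zpq := subset_itv_minmax xpq ypq zxy.
have zst : z \in `[s, t].
  by move: xst yst zxy; rewrite !in_itv/=; case: (leP x y); lra.
have costmM (u v : R) : u \in `[p, q] -> v \in `[p, q] -> u \in `[s, t] ->
    v \in `[s, t] -> u <= v ->
    (forall r, r \in `[u, v] -> a <= f r) -> Num.sqrt m * `|w v - w u| <= e t - e s.
  rewrite !in_itv/= => /andP[pu uq] /andP[pv vq] /andP[su ut] /andP[sv vt] uv af.
  apply: (@le_trans _ _ (e v - e u)); last by rewrite lerB// e_homo.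
  by apply: cost => // r ur rv; apply: mF; apply: af; rewrite in_itv/= ur.
have sqm : 0 <= Num.sqrt m by exact: sqrtr_ge0.
have norm_le : `|w y - 1| - a <= `|w y - w z|.
  rewrite -fz /f (le_trans (lerB_dist _ _))//.
  by rewrite opprB addrA subrK.
apply: (le_trans (ler_wpM2l sqm norm_le)).
have [zy|yz] := leP z y.
  by apply: costmM => // r; move: (fzy r); case: (leP z y) zy.
rewrite distrC; apply: costmM => //; first exact: ltW.
by move=> r; move: (fzy r); case: (leP z y) yz.
Qed.

End energy_control.

Section limit_of_graphs.
Context {R : realType}.
Variables (p q : R) (F : R -> R) (eps : nat -> R) (C : R).
Variables (w e : nat -> R -> R).
Hypothesis pq : p < q.
Hypothesis well : forall d, 0 < d ->
  exists2 m, 0 < m & forall y, d <= `|y - 1| -> m <= F y.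
Hypothesis eps_gt0 : forall j, 0 < eps j.
Hypothesis eps0 : eps j @[j --> \oo] --> 0.
Hypothesis we : forall j, energy_control p q F (eps j) C (w j) (e j).

(** If |w - 1| >= d on all of [s, t], the second energy inequality gives m (t - s) <= 2 eps C, which
    fails for small eps. *)
Lemma values_near_1 (s t d : R) : p <= s -> s < t -> t <= q -> 0 < d ->
  \forall j \near \oo, exists2 x, x \in `[s, t] & `|w j x - 1| < d.
Proof.
move=> ps st tq d0; have [m m0 mF] := well d0.
have C0 : 0 <= C by have [_ _ /(_ 0)/andP[a b] _ _] := we 0%N; exact: le_trans a b.
(* The denominator uses C + 1 so as to stay positive when C = 0. *)
pose r := m * (t - s) / (2 * (C + 1)).
have r0 : 0 < r by rewrite divr_gt0 ?mulr_gt0// ?subr_gt0// ltr_wpDl.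
near=> j.
have epsr : eps j < r.
  have : `|0 - eps j| < r by near: j; move/cvgrPdist_lt : eps0; exact.
  by rewrite sub0r normrN; apply: le_lt_trans; exact: ler_norm.
apply: contrapT => nx; have [_ _ eC _ cost] := we j.
have := cost m s t m0 ps (ltW st) tq; apply/not_implyP; split.
  move=> x sx xt; apply: mF; rewrite leNgt; apply/negP => wx; apply: nx.
  by exists x => //; rewrite in_itv/= sx.
apply/negP; rewrite -ltNge.
have [/andP[es _] /andP[_ et]] := (eC s, eC t).
have ets : e j t - e j s <= C by lra.
have : 2 * eps j * (e j t - e j s) <= 2 * eps j * C.
  by rewrite ler_wpM2l// mulr_ge0// ltW.
move: epsr; rewrite /r ltr_pdivlMr; last by rewrite mulr_gt0// ltr_wpDl.
have := eps_gt0 j; nra.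
Unshelve. all: end_near. Qed.

Lemma uniformly_bounded : exists B,
  \forall j \near \oo, forall x, x \in `[p, q] -> `|w j x| <= B.
Proof.
have [m m0 mF] := well (@ltr01 R).
(* An excursion from level 1 rises by at most C / sqrt m; one unit of the 2 is that level, the other
   passes from |w - 1| to |w|. *)
exists (C / Num.sqrt m + 2); near=> j => y ypq.
have [x xpq /ltW x1] : exists2 x, x \in `[p, q] & `|w j x - 1| < 1.
  by near: j; exact: values_near_1.
have sqm : 0 < Num.sqrt m by rewrite sqrtr_gt0.
suff : `|w j y - 1| <= C / Num.sqrt m + 1.
  by have := ler_normD (w j y - 1) 1; rewrite subrK normr1; lra.
rewrite -lerBlDr; have [y1|/ltW y1] := leP `|w j y - 1| 1.
  apply: (@le_trans _ _ 0); first by rewrite subr_le0.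
  rewrite divr_ge0 ?sqrtr_ge0//; have [_ _ /(_ 0)/andP[a b] _ _] := we j.
  exact: le_trans a b.
rewrite ler_pdivlMr// mulrC.
apply: (le_trans (excursion_cost (we j) m0 mF xpq ypq xpq ypq x1 y1)).
by have [_ _ eC _ _] := we j; have /andP[_ ?] := eC q; have /andP[? _] := eC p; lra.
Unshelve. all: end_near. Qed.

Definition graph_on (j : nat) : set (R * R) :=
  [set z | z.1 \in `[p, q] /\ w j z.1 = z.2].

Local Notation X := (klim graph_on).

Lemma klim_graph_near t y : X (t, y) -> forall d, 0 < d ->
  \forall j \near \oo, exists x, [/\ x \in `[p, q], `|t - x| < d & `|y - w j x| < d].
Proof.
move=> Xty d d0; apply: filterS (Xty d d0) => j [[x _] [[/= xpq <-] [/= tx yx]]].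
by exists x.
Qed.

Lemma klim_graph1 t : t \in `[p, q] -> X (t, 1).
Proof.
rewrite in_itv/= => /andP[pt tq] d d0.
(* The window around [t] is cut to [p, q]; it stays nondegenerate at the endpoints since p < q. *)
pose s := Num.max p (t - d / 2); pose u := Num.min q (t + d / 2).
have : \forall j \near \oo, exists2 x, x \in `[s, u] & `|w j x - 1| < d.
  apply: values_near_1 => //; first by rewrite le_max lexx.
    by rewrite gt_max !lt_min pq /=; lra.
  by rewrite ge_min lexx.
apply: filterS => j [x];
  rewrite in_itv/= ge_max le_min => /andP[/andP[px tx] /andP[xq xt]] wx.
exists (x, w j x); split; first by split => //=; rewrite in_itv/= px.
by split => /=; rewrite /ball/=; [rewrite ltr_distlC; lra|rewrite distrC].
Qed.

(** Near [t] the function [w j] takes values close to [y] and values close to 1, hence also the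
    value [y'] in between. *)
Lemma klim_graph_between t y y' : t \in `[p, q] -> X (t, y) ->
  (1 <= y' <= y) || (y <= y' <= 1) -> X (t, y').
Proof.
move=> tpq Xty y1y; have Xt1 := klim_graph1 tpq.
have [->//|y'y] := eqVneq y' y; have [->//|y'1] := eqVneq y' 1.
(* With this tolerance the approximate values of [y] and 1 lie on opposite sides of [y']. *)
move=> d d0; pose r := Num.min d (Num.min `|y' - y| `|y' - 1|).
have r0 : 0 < r by rewrite !lt_min d0 !normr_gt0 !subr_eq0 y'y y'1.
have [rd ry r1] : [/\ r <= d, r <= `|y' - y| & r <= `|y' - 1|].
  by rewrite /r !ge_min !lexx !orbT.
apply: filterS2 (klim_graph_near Xty r0) (klim_graph_near Xt1 r0) => j.
move=> [x1 [x1pq tx1 wx1]] [x2 [x2pq tx2 wx2]].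
have cw (u v : R) : u \in `[p, q] -> v \in `[p, q] ->
  {within `[Num.min u v, Num.max u v], continuous (w j)}.
  move=> upq vpq; apply: (@continuous_subspaceW _ _ _ `[p, q]);
    first exact: subset_itv_minmax.
  by have [] := we j.
have [x xpq [tx wx]] : exists2 x, x \in `[p, q] & `|t - x| < d /\ w j x = y'.
  move: wx1 wx2 tx1 tx2; rewrite !ltr_distlC => /andP[a1 a2] /andP[b1 b2] c1 c2.
  have [/andP[h1 h2]|/andP[h1 h2]] := orP y1y.
    have [x xI wx] : exists2 x, x \in `[Num.min x2 x1, Num.max x2 x1] & w j x = y'.
      apply: IVT_unordered; first exact: cw.
        by move: r1; rewrite ger0_norm; lra.
      by move: ry; rewrite ler0_norm; lra.
    exists x; first exact: subset_itv_minmax xI.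
    by split => //; rewrite ltr_distlC; move: xI c1 c2; rewrite in_itv/=;
      case: (leP x2 x1); lra.
  have [x xI wx] : exists2 x, x \in `[Num.min x1 x2, Num.max x1 x2] & w j x = y'.
    apply: IVT_unordered; first exact: cw.
      by move: ry; rewrite ger0_norm; lra.
    by move: r1; rewrite ler0_norm; lra.
  exists x; first exact: subset_itv_minmax xI.
  by split => //; rewrite ltr_distlC; move: xI c1 c2; rewrite in_itv/=;
    case: (leP x1 x2); lra.
exists (x, y'); split => //; split => //=.
by rewrite /ball/= subrr normr0.
Qed.

Let freq_le (t c : R) := forall N, exists2 j, (N <= j)%N & c <= e j t.

(** This is the upper limit of [e j t] in [j]. It exists for every [t] without extracting a further
    subsequence, and a gap common to all late [j] survives in it. *)
Let limsup_e (t : R) := sup [set c | freq_le t c].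

Let freq_leS (s t k : R) : (\forall j \near \oo, e j s + k <= e j t) ->
  limsup_e s + k <= limsup_e t.
Proof.
move=> [N0 _ N0P].
have has_sup_e u : has_sup [set c | freq_le u c].
  split; first by exists 0 => N; exists N => //; have [_ _ /(_ u)/andP[]] := we N.
  exists C => c /(_ 0%N)[j _ /le_trans]; apply.
  by have [_ _ /(_ u)/andP[]] := we j.
rewrite -lerBrDr; apply: ge_sup; first by case: (has_sup_e s).
move=> c sc; rewrite lerBrDr; apply: sup_upper_bound => // N.
have [j Nj cj] := sc (maxn N N0); exists j.
  by rewrite (leq_trans _ Nj)// leq_maxl.
apply: le_trans (N0P j _); first by rewrite lerD2r.
by rewrite /= (leq_trans _ Nj)// leq_maxr.
Qed.

Lemma klim_graph_countable : countable [set t | exists2 y, X (t, y) & y != 1].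
Proof.
apply: (@nondecreasing_jumps_countable _ limsup_e) => [s t st|t [y Xty y1]].
  rewrite -[leLHS]addr0; apply: freq_leS; apply: nearW => j; rewrite addr0.
  by have [_ + _ _ _] := we j; apply.
have d0 : 0 < `|y - 1| by rewrite normr_gt0 subr_eq0.
(* A value within [d] of [y] is at distance at least 2d from 1, so going there from a value within
   [d] of 1 costs at least sqrt m * d. *)
pose d := `|y - 1| / 4.
have d40 : 0 < d by rewrite divr_gt0.
have tpq : t \in `[p, q].
  pose K := [set z : R * R | z.1 \in `[p, q]].
  have cK : closed K.
    apply: (@closed_comp _ _ (fst : R * R -> R) [set` `[p, q]]);
      last exact: interval_closed.
    by move=> z _; exact: cvg_fst.
  have GK : \forall j \near \oo, graph_on j `<=` K by apply: nearW => j z [].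
  exact: (klim_sub cK GK Xty).
have [m m0 mF] := well d40.
exists (Num.sqrt m * d); first by rewrite mulr_gt0// sqrtr_gt0.
move=> s u st tu; apply: freq_leS.
(* The approximating abscissae then fall in [s, u]. When [t] is an endpoint of [p, q], [s] or [u]
   may lie outside, so [e] is monotone on the whole line. *)
pose r := Num.min d (Num.min (t - s) (u - t)).
have r0 : 0 < r by rewrite !lt_min d40 !subr_gt0 st tu.
have [rd rs ru] : [/\ r <= d, r <= t - s & r <= u - t].
  by rewrite /r !ge_min !lexx !orbT.
apply: filterS2 (klim_graph_near Xty r0) (klim_graph_near (klim_graph1 tpq) r0) => j.
move=> [x1 [x1pq tx1 wx1]] [x2 [x2pq tx2 wx2]].
have x1su : x1 \in `[s, u] by move: tx1; rewrite in_itv/= ltr_distlC; lra.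
have x2su : x2 \in `[s, u] by move: tx2; rewrite in_itv/= ltr_distlC; lra.
have w2 : `|w j x2 - 1| <= d by rewrite distrC; lra.
have w1 : d + d <= `|w j x1 - 1|.
  have := ler_distD (w j x1) y 1.
  have : `|y - 1| = 4 * d by rewrite /d mulrC divfK.
  lra.
have w1d : d <= `|w j x1 - 1| by lra.
have := excursion_cost (we j) m0 mF x2pq x1pq x2su x1su w2 w1d.
have : Num.sqrt m * d <= Num.sqrt m * (`|w j x1 - 1| - d).
  by rewrite ler_wpM2l ?sqrtr_ge0//; lra.
lra.
Qed.

End limit_of_graphs.

(** * Compactness of the graphs over the parameter interval *)

Section parameter_space.
Context {R : realType}.
Variables (p q : R) (F : R -> R) (eps : nat -> R) (C : R).
Variables (w e : nat -> R -> R).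
Hypothesis pq : p < q.
Hypothesis well : forall d, 0 < d ->
  exists2 m, 0 < m & forall y, d <= `|y - 1| -> m <= F y.
Hypothesis eps_gt0 : forall j, 0 < eps j.
Hypothesis eps0 : eps j @[j --> \oo] --> 0.
Hypothesis we : forall j, energy_control p q F (eps j) C (w j) (e j).

Lemma graph_subsequence : exists (sigma : nat -> nat) (X : set (R * R)),
  (forall m n, (m < n)%N -> (sigma m < sigma n)%N) /\
  [/\ compact X, (forall z, X z -> z.1 \in `[p, q]),
      (forall t, t \in `[p, q] -> X (t, 1)),
      (forall t y y', X (t, y) -> (1 <= y' <= y) || (y <= y' <= 1) -> X (t, y')) &
      countable [set t | exists2 y, X (t, y) & y != 1]] /\
  forall d, 0 < d -> \forall k \near \oo,
    (forall t, t \in `[p, q] ->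
      exists z, [/\ X z, `|t - z.1| < d & `|w (sigma k) t - z.2| < d]) /\
    (forall z, X z -> exists t, [/\ t \in `[p, q],
      `|z.1 - t| < d & `|z.2 - w (sigma k) t| < d]).
Proof.
have [c cP] := ratr_ball_basis R.
have [sigma [sigma_incr limsupG]] := kuratowski_extraction (graph_on p q w) cP.
have sigma_cvg : sigma k @[k --> \oo] --> \oo.
  have le_sigma k : (k <= sigma k)%N.
    by elim: k => // k /leq_ltn_trans; apply; exact: sigma_incr.
  move=> A [N _ NA]; exists N => // k /= Nk; apply: NA => /=.
  exact: leq_trans (le_sigma k).
pose ws k := w (sigma k); pose es k := e (sigma k).
(* The subsequence satisfies the same hypotheses, so the description of the lower limit applies to
   it. *)
have wse k : energy_control p q F (eps (sigma k)) C (ws k) (es k) by exact: we.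
have eps0s : eps (sigma k) @[k --> \oo] --> 0 by exact: cvg_comp eps0.
have [B wB] := uniformly_bounded pq well (fun k => eps_gt0 (sigma k)) eps0s wse.
pose K := [set` `[p, q]] `*` [set` `[- B, B]].
have cK : compact K by apply: compact_setX; exact: segment_compact.
have clK : closed K by apply: compact_closed => //; exact: norm_hausdorff.
have GK : \forall k \near \oo, graph_on p q ws k `<=` K.
  apply: filterS wB => k wB [t y] [/= tpq <-]; split => //=.
  by rewrite in_itv/= -ler_norml wB.
have XK := klim_sub clK GK.
exists sigma, (klim (graph_on p q ws)); split => //; split.
  split.
  - by apply: subclosed_compact XK => //; exact: closed_klim.
  - by move=> z /XK[].
  - exact: (klim_graph1 pq well (fun k => eps_gt0 (sigma k)) eps0s wse).
  - move=> t y y' Xty; apply: (klim_graph_between pq well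
      (fun k => eps_gt0 (sigma k)) eps0s wse _ Xty).
    by have [] := XK _ Xty.
  - exact: (klim_graph_countable pq well (fun k => eps_gt0 (sigma k)) eps0s wse).
move=> d d0;
apply: filterS2 (klim_excess_l cK GK limsupG d0) (klim_excess_r cK XK d0) => k Hl Hr.
split=> [t tpq|z Xz].
  have [z [Xz [/= tz wz]]] := Hl (t, ws k t) (conj tpq erefl).
  by exists z.
by have [[t y] [[/= tpq <-] [/= zt zw]]] := Hr z Xz; exists t.
Qed.

End parameter_space.

(** * From the parameter interval to M *)

Section charts.
Context {R : realType}.
Implicit Type M : space1 R.

Definition pmin M : R := if M is ClosedInterval a _ _ then a else 0.
Definition pmax M : R := if M is ClosedInterval _ b _ then b else 1.

Lemma pmin_lt_pmax M : pmin M < pmax M.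
Proof. by case: M => //= a b ab; exact: ltr01. Qed.

Lemma paramsE M : params M = `[pmin M, pmax M]%classic.
Proof. by case: M. Qed.

Lemma mdist_chart M s t : mdist (chart M s) (chart M t) <= `|s - t|.
Proof.
case: M => [a b ab|] /=; first by rewrite distrC.
exact: torus_dist_le.
Qed.

Lemma chart_continuous M : continuous (chart M).
Proof.
move=> t; apply/cvg_ballP => d d0; near=> s.
rewrite ballEmdist /=; apply: le_lt_trans (mdist_chart M t s) _.
by near: s; exact: (nbhsx_ballx t d d0).
Unshelve. all: end_near. Qed.

Lemma chart_points M t : t \in `[pmin M, pmax M] -> points M (chart M t).
Proof. by case: M => [a b ab|] //=. Qed.

Lemma points_chart M x : points M x ->
  exists2 t, t \in `[pmin M, pmax M] & chart M t = x.
Proof.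
case: M x => [a b ab|] /= x; first by exists x.
have [t <-] := torus_pi_surj x => _.
exists (t - (Num.floor t)%:~R).
  rewrite in_itv/= subr_ge0 floor_le /= lerBlDl; apply/ltW.
  by have := floorD1_gt t; rewrite intrD mulr1z.
apply/torus_piP; rewrite addrAC subrr add0r rpredN; exact: intr_int.
Qed.

End charts.

Section transfer.
Context {R : realType}.
Variables (M : space1 R).
Implicit Types (v : ambient M -> R).

Lemma dist2_le (z w : ambient M * R) (d : R) : 0 <= d ->
  mdist z.1 w.1 <= d -> `|z.2 - w.2| <= d -> dist2 z w <= d + d.
Proof.
move=> d0 h1 h2; rewrite /dist2 -[leRHS]ger0_norm ?addr_ge0// -(sqrtr_sqr (d + d)).
have := mdist_ge0 z.1 w.1; have := normr_ge0 (z.2 - w.2).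
move=> g2 g1; rewrite ler_sqrt ?sqr_ge0//; nra.
Qed.

Lemma excess_le (A B : set (ambient M * R)) (d : R) :
  (forall z, A z -> exists2 w, B w & dist2 z w <= d) -> (excess A B <= d%:E)%E.
Proof.
move=> AB; apply: ge_ereal_sup => _ [z Az <-]; have [w Bw zw] := AB z Az.
by apply: ereal_inf_le; exists (dist2 z w)%:E; [exists w | rewrite lee_fin].
Qed.

Lemma excess_ge0 (A B : set (ambient M * R)) : A !=set0 -> (0 <= excess A B)%E.
Proof.
move=> [z Az]; apply: (@le_trans _ _ (ereal_inf [set (dist2 z w)%:E | w in B])).
  by apply: le_ereal_inf_tmp => _ [w Bw <-]; rewrite lee_fin sqrtr_ge0.
by apply: ereal_sup_ubound; exists z.
Qed.

(** The distance takes extended real values: it is nonnegative because the graph of [v k] is not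
    empty, and finite for large [k] because it is eventually at most 1. *)
Lemma graph_cvg_le (v : nat -> ambient M -> R) (Xi : ambient M -> set R) :
  (forall d, 0 < d -> \forall k \near \oo, (d_g (singleton_fun (v k)) Xi <= d%:E)%E) ->
  graph_cvg v Xi.
Proof.
move=> H; have d_ge0 k : (0 <= d_g (singleton_fun (v k)) Xi)%E.
  rewrite /d_g /d_H le_max excess_ge0//.
  exists (chart M (pmin M), v k (chart M (pmin M))); split => //=.
  by apply: chart_points; rewrite in_itv/= lexx ltW// pmin_lt_pmax.
apply/fine_cvgP; split.
  by apply: filterS (H 1 ltr01) => k k1; rewrite ge0_fin_numE// (le_lt_trans k1)// ltry.
apply/cvgrPdist_le => d d0; apply: filterS (H d d0) => k kd.
rewrite sub0r normrN ger0_norm/= ?fine_ge0//.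
by rewrite -lee_fin fineK// ge0_fin_numE// (le_lt_trans kd)// ltry.
Qed.

(** The limit is the image of [X] under the chart in the first coordinate. Continuity of the chart
    preserves compactness, and its Lipschitz bound preserves closeness of graphs. *)
Lemma chart_graph_cvg (v : nat -> ambient M -> R) (X : set (R * R)) :
  compact X -> (forall z, X z -> z.1 \in `[pmin M, pmax M]) ->
  (forall t, t \in `[pmin M, pmax M] -> X (t, 1)) ->
  (forall t y y', X (t, y) -> (1 <= y' <= y) || (y <= y' <= 1) -> X (t, y')) ->
  countable [set t | exists2 y, X (t, y) & y != 1] ->
  (forall d, 0 < d -> \forall k \near \oo,
    (forall t, t \in `[pmin M, pmax M] ->
       exists z, [/\ X z, `|t - z.1| < d & `|v k (chart M t) - z.2| < d]) /\
    (forall z, X z ->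
       exists t, [/\ t \in `[pmin M, pmax M],
         `|z.1 - t| < d & `|z.2 - v k (chart M t)| < d])) ->
  exists Xi : ambient M -> set R, calA0 Xi /\ graph_cvg v Xi.
Proof.
move=> cX Xpq X1 Xbetween Xcount Xcvg.
(* Over the point 0 = 1 of the torus this is the union of two intervals; it is an
   interval since both contain 1. *)
pose Xi x : set R := [set y | exists2 t, chart M t = x & X (t, y)].
have graphE : graph Xi = (fun z : R * R => (chart M z.1, z.2)) @` X.
  apply/seteqP; split => [[x y] [/= px [t tx Xty]]|_ [[t y] Xty <-]].
    by exists (t, y) => //=; rewrite tx.
  by split => /=; [apply: chart_points; exact: Xpq Xty|exists t].
have cgraph : compact (graph Xi).
  rewrite graphE; apply: continuous_compact => //; apply: continuous_subspaceT => z.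
  apply: (@cvg_pair _ _ _ _ (nbhs (chart M z.1)) (nbhs z.2)); last exact: cvg_snd.
  by apply: (@continuous_comp _ _ _ fst (chart M));
    [exact: cvg_fst | exact: chart_continuous].
have cXi x : compact (Xi x).
  (* The fibre is the projection of a closed slice of the compact graph. *)
  have -> : Xi x = snd @` (graph Xi `&` (fst @^-1` [set x])).
    rewrite graphE; apply/seteqP;
      split => [y [t tx Xty]|_ [_ [[[t y] Xty <-] /= tx] <-]].
      by exists (x, y) => //; split => //; exists (t, y) => //=; rewrite tx.
    by exists t.
  apply: continuous_compact; first by apply: continuous_subspaceT => z; exact: cvg_snd.
  apply: compact_closedI => //; apply: closed_comp; first by move=> z _; exact: cvg_fst.
  by apply: compact_closed; [exact: metric_hausdorff | exact: compact_set1].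
have Xi1 x : points M x -> Xi x 1.
  by move=> /points_chart[t tpq tx]; exists t => //; exact: X1.
have Xi_between x y y' : Xi x y -> (1 <= y' <= y) || (y <= y' <= 1) -> Xi x y'.
  by move=> [t tx Xty] yy'; exists t => //; exact: Xbetween yy'.
(* The ends are the minimum and maximum of the compact fibre; what lies between them is filled in
   from 1 outwards to each end. *)
have Xi_itv x : points M x -> exists l u, [/\ l <= 1, 1 <= u & Xi x = `[l, u]%classic].
  move=> px; have cid : {within Xi x, continuous (id : R -> R)}.
    by apply: continuous_subspaceT => ?; exact: cvg_id.
  have Xi0 : Xi x !=set0 by exists 1; exact: Xi1.
  have [l /set_mem Xl lmin] := compact_EVT_min Xi0 (cXi x) cid.
  have [u /set_mem Xu umax] := compact_EVT_max Xi0 (cXi x) cid.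
  have Xi1x := mem_set (Xi1 x px).
  exists l, u; split; [exact: lmin | exact: umax | apply/seteqP; split => y /=].
    by move=> /mem_set Xy; rewrite in_itv/= lmin// umax.
  rewrite in_itv/= => /andP[ly yu]; have [y1|/ltW y1] := leP y 1.
    by apply: (Xi_between x l) => //; rewrite ly y1 orbT.
  by apply: (Xi_between x u) => //; rewrite y1 yu.
exists Xi; split.
  split.
  - by split => // x _; exact: cXi.
  - move=> x /Xi_itv[l [u [l1 u1 ->]]]; exists l, u; split => //; exact: le_trans u1.
  - exists (chart M @` [set t | exists2 y, X (t, y) & y != 1]); split.
    + by move=> _ [t [y Xty _] <-]; apply: chart_points; exact: Xpq Xty.
    + exact: card_le_trans (card_image_le _ _) Xcount.
    + move=> x px nx; apply/seteqP; split => [y [t tx Xty]|_ ->]; last exact: Xi1.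
      by have [//|y1] := eqVneq y 1; case: nx; exists t => //; exists y.
    + move=> x [t [y Xty y1] tx].
      have px : points M x by rewrite -tx; apply: chart_points; exact: Xpq Xty.
      have [l [u [l1 u1 XiE]]] := Xi_itv x px.
      exists l, u; split => //.
      have : Xi x y by exists t.
      rewrite XiE /= in_itv/= => /andP[ly yu].
      by move: y1; rewrite neq_lt => /orP[]; lra.
(* Half of [d] for each coordinate, since [dist2_le] bounds the product distance by the sum. *)
apply: graph_cvg_le => d d0; have d20 : 0 < d / 2 by rewrite divr_gt0.
apply: filterS (Xcvg _ d20) => k [Hl Hr].
rewrite /d_g /d_H ge_max; apply/andP; split; apply: excess_le.
  move=> [x y] [/= /points_chart[t tpq <-] ->]; have [[s y'] [Xz /= ts wy]] := Hl t tpq.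
  exists (chart M s, y'); first by rewrite graphE; exists (s, y').
  rewrite (splitr d); apply: dist2_le => /=; rewrite ?(ltW d20) ?(ltW wy)//.
  exact: le_trans (mdist_chart M _ _) (ltW ts).
rewrite graphE => _ [[s y] Xz <-]; have [t [tpq /= ts wy]] := Hr _ Xz.
exists (chart M t, v k (chart M t)); first by split => //=; exact: chart_points.
rewrite (splitr d); apply: dist2_le => /=; rewrite ?(ltW d20) ?(ltW wy)//.
exact: le_trans (mdist_chart M _ _) (ltW ts).
Qed.

End transfer.

(** * Pointwise variation and weak derivatives *)

Section spline.
Context {R : realType}.
Implicit Types x h c d : R.

Definition pos x : R := Num.max x 0.

Lemma pos_lip x y : `|pos x - pos y| <= `|x - y|.
Proof.
rewrite /pos; case: (leP x 0); case: (leP y 0); rewrite ler_norml;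
  case: (ger0P (x - y)); lra.
Qed.

Lemma continuous_pos : continuous pos.
Proof.
move=> x; apply/cvgrPdist_lt => d d0; near=> y.
apply: le_lt_trans (pos_lip _ _) _; near: y.
exact: (nbhsx_ballx x d d0).
Unshelve. all: end_near. Qed.

(* The remainder is at most [h ^+ 2], which covers the kink of [pos] at 0. *)
Lemma is_derive_pos2 x : is_derive x 1 (fun y => pos y ^+ 2) (2 * pos x).
Proof.
have cvg : h^-1 *: (((fun y => pos y ^+ 2) \o shift x) (h *: 1) - pos x ^+ 2)
    @[h --> 0^'] --> 2 * pos x.
  apply/cvgrPdist_le => d d0; near=> h.
  have h0 : h != 0 by near: h; exact: nbhs_dnbhs_neq.
  have hd : `|h| <= d.
    by apply/ltW; near: h; exact: dnbhs0_lt.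
  rewrite /= -(ler_pM2l (_ : 0 < `|h|)) ?normr_gt0// -normrM mulrBr.
  rewrite /GRing.scale /= [X in _ - X]mulrA divff// mul1r mulr1.
  apply: (@le_trans _ _ (h ^+ 2)).
    rewrite ler_norml /pos; case: (leP x 0); case: (leP (h + x) 0); nra.
  by rewrite -(real_normK (num_real h)) expr2 ler_pM2l ?normr_gt0.
by apply: DeriveDef; [apply/cvg_ex; exists (2 * pos x)|apply: cvg_lim].
Unshelve. all: end_near. Qed.

(* [spline] is a C^1 step from 0 to 1 over [0, 2] with derivative [hat]. *)
Definition spline x : R := (pos x ^+ 2 - 2 * pos (x - 1) ^+ 2 + pos (x - 2) ^+ 2) / 2.
Definition hat x : R := pos x - 2 * pos (x - 1) + pos (x - 2).

Lemma spline_le0 x : x <= 0 -> spline x = 0.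
Proof.
by move=> x0; rewrite /spline /pos; case: (leP x 0); case: (leP (x-1) 0);
  case: (leP (x-2) 0); lra.
Qed.

Lemma spline_ge2 x : 2 <= x -> spline x = 1.
Proof.
by move=> x0; rewrite /spline /pos; case: (leP x 0); case: (leP (x-1) 0);
  case: (leP (x-2) 0); nra.
Qed.

Lemma spline_ge0 x : 0 <= spline x.
Proof.
rewrite /spline /pos; case: (leP x 0); case: (leP (x-1) 0); case: (leP (x-2) 0); nra.
Qed.

Lemma spline_le1 x : spline x <= 1.
Proof.
rewrite /spline /pos; case: (leP x 0); case: (leP (x-1) 0); case: (leP (x-2) 0); nra.
Qed.

Lemma hat_le0 x : x <= 0 -> hat x = 0.
Proof.
by move=> x0; rewrite /hat /pos; case: (leP x 0); case: (leP (x-1) 0);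
  case: (leP (x-2) 0); lra.
Qed.

Lemma hat_ge2 x : 2 <= x -> hat x = 0.
Proof.
by move=> x0; rewrite /hat /pos; case: (leP x 0); case: (leP (x-1) 0);
  case: (leP (x-2) 0); lra.
Qed.

Lemma hat_ge0 x : 0 <= hat x.
Proof.
rewrite /hat /pos; case: (leP x 0); case: (leP (x-1) 0); case: (leP (x-2) 0); lra.
Qed.

(** For d > 0 the step takes place on [c, c + 2d], and [hat_at] is a bump of integral 1 there. *)
Definition spline_at c d x := spline ((x - c) / d).
Definition hat_at c d x := hat ((x - c) / d) / d.

Lemma continuous_hat_at c d : continuous (hat_at c d).
Proof.
have cpos a : continuous (fun x => pos (x - a)).
  move=> x; apply: (@continuous_comp _ _ _ (fun x => x - a) pos);
    last exact: continuous_pos.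
  by apply: cvgB; [exact: cvg_id|exact: cvg_cst].
have chat : continuous hat.
  move=> x; apply: cvgD; last exact: cpos.
  apply: cvgB; first exact: continuous_pos.
  by apply: cvgMr; exact: cpos.
move=> x; apply: cvgMl.
apply: (@continuous_comp _ _ _ (fun x => (x - c) / d) hat); last exact: chat.
by apply: cvgMl; apply: cvgB; [exact: cvg_id|exact: cvg_cst].
Qed.

Lemma is_derive_spline_at c d x : is_derive x 1 (spline_at c d) (hat_at c d x).
Proof.
have dpos a : is_derive x 1
    (fun x => pos ((x - c) / d - a) ^+ 2) (2 * pos ((x - c) / d - a) / d).
  have aff : is_derive x 1 (fun x => (x - c) / d - a : R) d^-1.
    have := is_deriveB (is_deriveZ d^-1 (is_deriveB (is_derive_id x 1)
      (is_derive_cst c x 1))) (is_derive_cst a x 1).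
    rewrite !subr0 /GRing.scale/= mulr1; congr is_derive.
    by apply/funext => y; rewrite !fctE mulrC.
  have := @is_derive1_comp R (fun y => pos y ^+ 2)
    (fun x => (x - c) / d - a) x _ _ (is_derive_pos2 _) aff.
  by [].
have := is_deriveZ 2^-1 (is_deriveD (is_deriveB (dpos 0) (is_deriveZ 2 (dpos 1)))
  (dpos 2)).
congr is_derive.
  apply/funext => y; set z := (y - c) / d.
  change (2^-1 * (pos (z - 0) ^+ 2 - 2 * pos (z - 1) ^+ 2 + pos (z - 2) ^+ 2) =
    spline z).
  by rewrite subr0 mulrC.
by rewrite /hat_at /hat /GRing.scale/= subr0; lra.
Qed.

Lemma integral_hat_at c d p q : 0 < d -> p <= c -> c + 2 * d <= q ->
  (\int[@lebesgue_measure R]_(x in `[p, q]) hat_at c d x = 1)%R.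
Proof.
move=> d0 pc cq; rewrite /Rintegral.
have spline_diff x : derivable (spline_at c d) x 1.
  by have [] := is_derive_spline_at c d x.
have spline_cont x : {for x, continuous (spline_at c d)}.
  by apply: differentiable_continuous; apply/derivable1_diffP.
rewrite (@continuous_FTC2 _ _ (spline_at c d)).
- rewrite /spline_at spline_ge2 ?spline_le0//.
  + by rewrite /= subr0.
  + by rewrite ler_pdivrMr// mul0r subr_le0.
  + by rewrite ler_pdivlMr// lerBrDl.
- by apply: le_lt_trans pc _; apply: lt_le_trans cq; rewrite ltrDl mulr_gt0.
- by apply: continuous_subspaceT; exact: continuous_hat_at.
- split => //.
  + by apply: cvg_at_right_filter; exact: spline_cont.
  + by apply: cvg_at_left_filter; exact: spline_cont.
- by move=> x _; rewrite derive1E; have [_ ->] := is_derive_spline_at c d x.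
Qed.

End spline.

Section weak_variation.
Context {R : realType}.
Variables (p q : R) (W g : R -> R).
Notation mu := (@lebesgue_measure R).
Hypothesis W_cont : {within `[p, q], continuous W}.
Hypothesis g_int : mu.-integrable `[p, q] (EFin \o g).
(** Test functions live on the real line, come with their derivative and vanish off a compact part
    of ]p, q[; in this form one hypothesis covers both the interval and the torus. *)
Hypothesis weak : forall (phi rho : R -> R) a b, p < a -> b < q ->
  (forall x : R, is_derive x 1 phi (rho x)) -> continuous rho ->
  (forall x, x \notin `[a, b] -> phi x = 0 /\ rho x = 0) ->
  \int[mu]_(x in `[p, q]) (W x * rho x) = - \int[mu]_(x in `[p, q]) (g x * phi x).

Let D_int (f : R -> R) : {within `[p, q], continuous f} ->
  mu.-integrable `[p, q] (EFin \o f).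
Proof. by apply: continuous_compact_integrable; exact: segment_compact. Qed.

Let W_near (s d : R) : s \in `[p, q] -> 0 < d ->
  exists2 r, 0 < r & forall x, x \in `[p, q] -> `|x - s| < r -> `|W x - W s| <= d.
Proof.
move=> spq d0; have /subspace_continuousP/(_ s spq)/cvgrPdist_le/(_ d d0) := W_cont.
rewrite near_withinE => /nbhs_ballP[r /= r0 rP].
exists r => // x xpq xs; rewrite distrC; apply: rP => //.
by rewrite /ball/= distrC.
Qed.

(** The test function rises from 0 to 1 just after [s] and falls back just before [t]. Its
    derivative is a difference of two bumps of integral 1, so testing [W] against it gives W s - W t
    up to a small error, while the other side is at most the integral of |g| over [s, t]. *)
Lemma weak_variation_le s t : p <= s -> s <= t -> t <= q ->
  `|W t - W s| <= \int[mu]_(x in `[s, t]) `|g x|.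
Proof.
move=> ps; rewrite le_eqVlt => /predU1P[<- _|st tq].
  by rewrite subrr normr0; apply: Rintegral_ge0.
apply/ler_addgt0Pr => d' d'0; pose d := d' / 2.
have d0 : 0 < d by rewrite divr_gt0.
have spq : s \in `[p, q] by rewrite in_itv/= ps (le_trans (ltW st)).
have tpq : t \in `[p, q] by rewrite in_itv/= tq (le_trans ps (ltW st)).
have [r1 r10 r1P] := W_near spq d0; have [r2 r20 r2P] := W_near tpq d0.
(* The bumps occupy [s + h, s + 3h] and [t - 3h, t - h]: at most t - s over 6 keeps them from
   overlapping, and 3h < r1, 3h < r2 keep [W] within [d] of W s and W t. The margin [h] puts the
   support strictly inside ]p, q[ even for s = p or t = q. *)
pose h := Num.min ((t - s) / 6) (Num.min (r1 / 4) (r2 / 4)).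
have h0 : 0 < h by rewrite !lt_min !divr_gt0// subr_gt0.
have [hst h1 h2] : [/\ h <= (t - s) / 6, h <= r1 / 4 & h <= r2 / 4].
  by rewrite /h !ge_min !lexx !orbT.
pose c1 := s + h; pose c2 := t - 3 * h.
pose phi := spline_at c1 h - spline_at c2 h.
pose rho := hat_at c1 h - hat_at c2 h.
have hat_off c x : x < c \/ c + 2 * h < x -> hat_at c h x = 0.
  move=> [xc|cx]; rewrite /hat_at.
    by rewrite hat_le0 ?mul0r// ler_pdivrMr// mul0r subr_le0 ltW.
  by rewrite hat_ge2 ?mul0r// ler_pdivlMr// lerBrDl ltW.
have spline_off c x : (x < c -> spline_at c h x = 0) /\
    (c + 2 * h < x -> spline_at c h x = 1).
  split=> [xc|cx]; rewrite /spline_at.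
    by rewrite spline_le0// ler_pdivrMr// mul0r subr_le0 ltW.
  by rewrite spline_ge2// ler_pdivlMr// lerBrDl ltW.
have supp x : x \notin `[s + h, t - h] -> phi x = 0 /\ rho x = 0.
  rewrite in_itv/= negb_and -!ltNge => /orP[xs|xt].
    rewrite /phi /rho !fctE !hat_off; [|left; rewrite /c2; lra|left; rewrite /c1; lra].
    rewrite (spline_off _ _).1; last by rewrite /c1; lra.
    by rewrite (spline_off _ _).1 ?subrr//; rewrite /c2; lra.
  rewrite /phi /rho !fctE !hat_off; [|right; rewrite /c2; lra|right; rewrite /c1; lra].
  rewrite (spline_off _ _).2; last by rewrite /c1; lra.
  by rewrite (spline_off _ _).2 ?subrr//; rewrite /c2; lra.
have c_hat c : {within `[p, q], continuous (hat_at c h)}.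
  by apply: continuous_subspaceT; exact: continuous_hat_at.
have phi_der (x : R) : is_derive x 1 phi (rho x).
  exact: is_deriveB (is_derive_spline_at _ _ _) (is_derive_spline_at _ _ _).
have rho_cont : continuous rho by move=> x; apply: cvgB; exact: continuous_hat_at.
have eq_weak : \int[mu]_(x in `[p, q]) (W x * rho x) =
    - \int[mu]_(x in `[p, q]) (g x * phi x).
  by apply: (@weak phi rho (s + h) (t - h)) => //; lra.
have phi_le1 x : `|phi x| <= 1.
  rewrite /phi !fctE /spline_at ler_norml.
  have := spline_ge0 ((x - c1) / h); have := spline_ge0 ((x - c2) / h).
  have := spline_le1 ((x - c1) / h); have := spline_le1 ((x - c2) / h); lra.
have phi_cont : continuous phi.
  by move=> x; apply: differentiable_continuous; apply/derivable1_diffP;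
    have [] := phi_der x.
have gphi_meas : measurable_fun `[p, q] (fun x => g x * phi x).
  apply: measurable_funM; first by apply/measurable_EFinP; exact: measurable_int g_int.
  by apply: measurable_funTS; exact: continuous_measurable_fun.
have gphi_int : mu.-integrable `[p, q] (EFin \o (fun x => g x * phi x)).
  apply: le_integrable g_int => //; first exact/measurable_EFinP.
  by move=> x _; rewrite /= lee_fin normrM ler_piMr.
have gphi_le : `|\int[mu]_(x in `[p, q]) (g x * phi x)| <=
    \int[mu]_(x in `[s, t]) `|g x|.
  apply: (le_trans (le_normr_Rintegral _ gphi_int)) => //.
  have -> : `[s, t]%classic = `[p, q]%classic `&` `[s, t]%classic :> set R.
    by rewrite setIidr// => x /=; rewrite !in_itv/=; lra.
  rewrite Rintegral_mkcondr; apply: le_Rintegral => //.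
  - exact: integrable_norm gphi_int.
  - rewrite -restrict_EFin; apply/integrable_restrict => //.
    by apply: integrableS (integrable_norm g_int) => //; exact: measurableI.
  - move=> x _; rewrite patchE; case: ifPn => xst.
      by rewrite normrM ler_piMr.
    have [|-> _] := supp x; last by rewrite mulr0 normr0.
    by apply: contra xst => xst; apply/mem_set; move: xst; rewrite /= !in_itv/=; lra.
have Whc (k c : R) : mu.-integrable `[p, q] (EFin \o (fun x => k * hat_at c h x)).
  by apply: D_int => x; apply: cvgMr; exact: c_hat.
have Wrho_cont : {within `[p, q], continuous (fun x => W x * rho x)}.
  by move=> x; apply: cvgM; [exact: W_cont | exact: (continuous_subspaceT rho_cont)].
have int_hat c : p <= c -> c + 2 * h <= q -> forall k,
    \int[mu]_(x in `[p, q]) (k * hat_at c h x) = k.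
  by move=> pc cq k; rewrite RintegralZl ?integral_hat_at ?mulr1//; exact: D_int.
have i1 k := int_hat c1 ltac:(rewrite /c1; lra) ltac:(rewrite /c1; lra) k.
have i2 k := int_hat c2 ltac:(rewrite /c2; lra) ltac:(rewrite /c2; lra) k.
have hat_pos c x : 0 <= hat_at c h x by rewrite divr_ge0 ?hat_ge0// ltW.
have near1 x : x \in `[p, q] ->
    (W s - d) * hat_at c1 h x <= W x * hat_at c1 h x <= (W s + d) * hat_at c1 h x.
  move=> xpq; have [/(r1P _ xpq)|xs] := ltP `|x - s| r1.
    by rewrite ler_distl => /andP[? ?]; rewrite !ler_wpM2r.
  rewrite hat_off ?mulr0 ?lexx// /c1.
  by move: xs; case: (ger0P (x - s)) => _ ?; [right|left]; lra.
have near2 x : x \in `[p, q] ->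
    (W t - d) * hat_at c2 h x <= W x * hat_at c2 h x <= (W t + d) * hat_at c2 h x.
  move=> xpq; have [/(r2P _ xpq)|xt] := ltP `|x - t| r2.
    by rewrite ler_distl => /andP[? ?]; rewrite !ler_wpM2r.
  rewrite hat_off ?mulr0 ?lexx// /c2.
  by move: xt; case: (ger0P (x - t)) => _ ?; [right|left]; lra.
have upper : \int[mu]_(x in `[p, q]) (W x * rho x) <= (W s + d) - (W t - d).
  rewrite -[X in _ <= X - _](i1 (W s + d)) -[X in _ <= _ - X](i2 (W t - d)).
  rewrite -RintegralB//; apply: le_Rintegral => //; first exact: D_int.
    exact: (integrableB _ (Whc _ _) (Whc _ _)).
  move=> x /= xpq; rewrite /rho !fctE mulrBr.
  by have /andP[_ ?] := near1 x xpq; have /andP[? _] := near2 x xpq; exact: lerB.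
have lower : (W s - d) - (W t + d) <= \int[mu]_(x in `[p, q]) (W x * rho x).
  rewrite -[X in X - _ <= _](i1 (W s - d)) -[X in _ - X <= _](i2 (W t + d)).
  rewrite -RintegralB//; apply: le_Rintegral => //; last first.
  - move=> x /= xpq; rewrite /rho !fctE mulrBr.
    by have /andP[? _] := near1 x xpq; have /andP[_ ?] := near2 x xpq; exact: lerB.
  - exact: D_int.
  - exact: (integrableB _ (Whc _ _) (Whc _ _)).
move: gphi_le upper lower; rewrite eq_weak /d !ler_norml.
set I := Rintegral _ _ _; set J := Rintegral _ _ _; lra.
Qed.

End weak_variation.

(** * Test functions on M from test functions on the line *)

Section test_functions.
Context {R : realType}.

Definition frac (t : R) : R := t - (Num.floor t)%:~R.

Lemma frac_int_equiv s t : s - t \is a Num.int -> frac s = frac t.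
Proof.
move=> st; have -> : s = (s - t) + t by rewrite subrK.
rewrite /frac floorDzr//.
have /eqP <- : (Num.floor (s - t))%:~R == s - t by rewrite -intrEfloor.
by rewrite intrKfloor intrD; ring.
Qed.

(* Near an integer [t] both [frac t] and [t - floor t0] avoid the support. *)
Lemma near_frac (h : R -> R) a b (t0 : R) : 0 < a -> b < 1 ->
  (forall x, x \notin `[a, b] -> h x = 0) ->
  \forall t \near t0, h (t - (Num.floor t0)%:~R) = h (frac t).
Proof.
move=> a0 b1 hab; set n := Num.floor t0.
have t0I : t0 \in `](n%:~R - (1 - b)), (n%:~R + 1)[.
  have := floor_le t0; have := floorD1_gt t0; rewrite intrD mulr1z -/n in_itv/=; lra.
have : \forall t \near t0, t \in `](n%:~R - (1 - b)), (n%:~R + 1)[.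
  exact: near_in_itvoo.
apply: filterS => t; rewrite in_itv/= => /andP[nt tn].
have [nt'|tn'] := leP n%:~R t.
  suff -> : n = Num.floor t by [].
  by apply/esym/floor_def; rewrite nt' intrD mulr1z.
have ft := floor_le t; have ft1 := floorD1_gt t; rewrite intrD mulr1z in ft1.
have fn : (Num.floor t)%:~R + 1 <= n%:~R :> R.
  rewrite -[1](mulr1z) -intrD ler_int lezD1 -(ltr_int R); exact: le_lt_trans tn'.
rewrite !hab// /frac in_itv/= negb_and -!ltNge; apply/orP; [right|left]; lra.
Qed.

(** On the torus [phi] is restricted to [0, 1] and repeated periodically; this stays C^1 across the
    integers because [phi] vanishes near 0 and 1. *)
Lemma test_function (M : space1 R) (phi rho : R -> R) a b :
  pmin M < a -> b < pmax M ->
  (forall x : R, is_derive x 1 phi (rho x)) -> continuous rho ->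
  (forall x, x \notin `[a, b] -> phi x = 0 /\ rho x = 0) ->
  exists Phi : ambient M -> R, [/\ C1 Phi, supported Phi &
    forall t, t \in `[pmin M, pmax M] -> Phi (chart M t) = phi t /\ dx Phi t = rho t].
Proof.
case: M => [p q pq|] /= pa bq dphi crho supp.
  have dxE : @dx R (ClosedInterval pq) phi = rho.
    by apply/funext => t; rewrite /dx derive1E; have [_ ->] := dphi t.
  exists phi; split.
  - by split; [move=> t; have [] := dphi t | rewrite dxE].
  - have clab : closed `[a, b]%classic by exact: interval_closed.
    move=> t; have sub : [set x | phi x != 0] `<=` `[a, b]%classic.
      by move=> x /=; apply: contraNT => /supp[-> _].
    move=> /(closure_subset sub);
      rewrite -((closure_id _).1 clab) /= !in_itv/= => /andP[].
    by move=> /(lt_le_trans pa) -> /le_lt_trans ->.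
  - by move=> t _; rewrite dxE.
pose Phi (x : torus R) := phi (frac (repr x)).
have PhiE t : Phi (torus_pi t) = phi (frac t).
  congr phi; apply: frac_int_equiv; apply/torus_piP.
  by rewrite {1}/torus_pi reprK.
have der (t : R) : is_derive t 1 (Phi \o @chart R Torus) (rho (frac t)).
  have aff : is_derive t 1 (fun x : R => x - (Num.floor t)%:~R : R) 1.
    have := is_deriveB (is_derive_id t 1) (is_derive_cst ((Num.floor t)%:~R : R) t 1).
    by rewrite subr0.
  have := @is_derive1_comp R phi (fun x => x - (Num.floor t)%:~R) t _ _ (dphi _) aff.
  rewrite mulr1; apply: near_eq_is_derive.
  have := @near_frac phi a b t pa bq (fun x xab => (supp x xab).1).
  by apply: filterS => x /= ->; rewrite PhiE.
have dxE : @dx R Torus Phi = rho \o frac.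
  by apply/funext => t; rewrite /dx derive1E; have [_ ->] := der t.
exists Phi; split => //.
- split; first by move=> t; have [] := der t.
  rewrite dxE => t.
  have near_rho := @near_frac rho a b t pa bq (fun x xab => (supp x xab).2).
  apply: (@cvg_trans _ (rho (x - (Num.floor t)%:~R) @[x --> t])).
    apply: near_eq_cvg; apply: filterS near_rho => x.
    by rewrite /= => ->.
  suff : {for t, continuous (rho \o (fun x => x - (Num.floor t)%:~R))} by exact.
  apply: continuous_comp; last exact: crho.
  by apply: cvgB; [exact: cvg_id | exact: cvg_cst].
- move=> t; rewrite in_itv/= dxE /= PhiE => /andP[t0].
  rewrite le_eqVlt => /predU1P[->|t1].
    (* The parameter 1 is glued to 0, and both functions vanish at both points. *)
    have -> : frac 1 = 0 :> R by rewrite /frac floor1 mulr1z subrr.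
    have [-> ->] := supp 0 ltac:(by rewrite in_itv/= leNgt pa).
    by have [-> ->] := supp 1 ltac:(by rewrite in_itv/= negb_and -!ltNge bq orbT).
  suff -> : frac t = t by [].
  have -> : frac t = t - 0%:~R; last by rewrite mulr0z subr0.
  by rewrite /frac (@floor_def _ _ 0)// mulr0z t0 add0r mulr1z.
Qed.

End test_functions.

(** * From the Sobolev energy to pointwise energy control *)

Section energy.
Context {R : realType}.
Variable M : space1 R.
Notation mu := (@lebesgue_measure R).

Lemma Rintegral_primitiveB (u : R -> R) p q s t :
  mu.-integrable `[p, q] (EFin \o u) -> p <= s -> s <= t -> t <= q ->
  \int[mu]_(x in `[p, t]) u x - \int[mu]_(x in `[p, s]) u x =
  \int[mu]_(x in `[s, t]) u x.
Proof.
move=> iu ps st tq.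
have sub (a b : R) : p <= a -> b <= q -> mu.-integrable `[a, b] (EFin \o u).
  move=> pa bq; apply: integrableS iu => // x /=.
  by rewrite !in_itv/= => /andP[/(le_trans pa) -> /le_trans ->].
rewrite Rintegral_itvB ?bnd_simp//; last exact: sub.
rewrite Rintegral_itv_obnd_cbnd//; apply: integrableS (sub s t ps tq) => // x /=.
by rewrite !in_itv/= => /andP[/ltW -> ->].
Qed.

Lemma continuous_on_chart (v : ambient M -> R) : continuous_on v ->
  {within `[pmin M, pmax M], continuous (v \o chart M)}.
Proof.
move: v; case: M => [a b ab|] v //= cv.
apply: continuous_subspaceT => t; apply: continuous_comp;
  first exact: (@chart_continuous R Torus).
by move: cv; rewrite /continuous_on -continuous_subspace_setT; apply.
Qed.

Lemma L2_chart (v : ambient M -> R) : L2 v ->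
  mu.-integrable `[pmin M, pmax M] (EFin \o (fun t => `|v (chart M t)| ^+ 2)) /\
  mu.-integrable `[pmin M, pmax M] (EFin \o (v \o chart M)).
Proof.
rewrite /L2 paramsE => -[mv v2].
have v2_int : mu.-integrable `[pmin M, pmax M]
    (EFin \o (fun t => `|v (chart M t)| ^+ 2)).
  apply/integrableP; split.
    by apply/measurable_EFinP; apply: measurable_funX; apply: measurableT_comp.
  by under eq_integral do rewrite /= ger0_norm ?exprn_ge0//.
split => //.
have one_int : mu.-integrable `[pmin M, pmax M] (EFin \o cst (1 : R)).
  apply: continuous_compact_integrable; first exact: segment_compact.
  by apply: continuous_subspaceT => x; exact: cvg_cst.
(* On a bounded interval square integrability gives integrability through |y| <= 1 + |y|^2. *)
apply: le_integrable (integrableD _ one_int v2_int) => //.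
  exact/measurable_EFinP.
move=> t _; rewrite /= lee_fin.
set y := v _; rewrite [leRHS]ger0_norm ?addr_ge0 ?exprn_ge0//.
by have := normr_ge0 y; nra.
Qed.

Lemma weak_derivativeP (v : ambient M -> R) : H1 v ->
  is_weak_derivative v (weak_derivative v).
Proof. by move=> [_ _ [g vg]]; exact: (xgetPex (cst 0) (ex_intro _ g vg)). Qed.

Lemma H1_variation_le (v : ambient M -> R) (s t : R) : H1 v ->
  pmin M <= s -> s <= t -> t <= pmax M ->
  `|v (chart M t) - v (chart M s)| <=
    \int[mu]_(x in `[s, t]) `|weak_derivative v (chart M x)|.
Proof.
move=> vH1 ps st tq; have [cv _ _] := vH1.
have [g2 weak] := weak_derivativeP vH1.
apply: (@weak_variation_le _ (pmin M) (pmax M)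
  (v \o chart M) (weak_derivative v \o chart M)) => //.
- exact: continuous_on_chart.
- exact: (L2_chart g2).2.
move=> phi rho a b pa bq dphi crho supp.
have [Phi [C1Phi suppPhi PhiE]] := test_function pa bq dphi crho supp.
have := weak Phi C1Phi suppPhi; rewrite paramsE => H.
transitivity (\int[mu]_(x in `[pmin M, pmax M]) (v (chart M x) * dx Phi x)).
  by apply: eq_Rintegral => x /set_mem/PhiE[_ ->].
rewrite H; congr (- _).
by apply: eq_Rintegral => x /set_mem/PhiE[-> _].
Qed.

(** The function [e] is the primitive of the energy density [u]. Young's inequality gives the first
    estimate, and discarding the gradient term gives the second. *)
Lemma H1_energy_control (F : R -> R) (v : ambient M -> R) (eps C : R) :
  0 < eps -> continuous F -> (forall y, 0 <= F y) -> H1 v ->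
  (E_sMM F eps v <= C%:E)%E ->
  exists e, energy_control (pmin M) (pmax M) F eps C (v \o chart M) e.
Proof.
move=> eps0 cF F0 vH1 EC; set p := pmin M; set q := pmax M.
have pq : p <= q by exact/ltW/pmin_lt_pmax.
have [cv _ _] := vH1; have [g2 _] := weak_derivativeP vH1.
have [g2_int g_int] := L2_chart g2.
have cW := continuous_on_chart cv.
pose g t := weak_derivative v (chart M t); pose W t := v (chart M t).
have FW_int : mu.-integrable `[p, q] (EFin \o (fun t => F (W t))).
  apply: continuous_compact_integrable; first exact: segment_compact.
  by move=> t; apply: continuous_comp; [exact: cW | exact: cF].
pose u1 t := eps / 2 * `|g t| ^+ 2; pose u2 t := (2 * eps)^-1 * F (W t).
have u1_int : mu.-integrable `[p, q] (EFin \o u1).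
  have := integrableZl _ (eps / 2) g2_int; apply => //.
have u2_int : mu.-integrable `[p, q] (EFin \o u2).
  have := integrableZl _ (2 * eps)^-1 FW_int; apply => //.
pose u t := u1 t + u2 t.
have u_int : mu.-integrable `[p, q] (EFin \o u) by exact: (integrableD _ u1_int u2_int).
have ce0 : 0 < eps / 2 by rewrite divr_gt0.
have ce1 : 0 < (2 * eps)^-1 by rewrite invr_gt0 mulr_gt0.
have u1_ge0 t : 0 <= u1 t by rewrite mulr_ge0 ?exprn_ge0// ltW.
have u2_ge0 t : 0 <= u2 t by rewrite mulr_ge0 ?F0// ltW.
have u_ge0 t : 0 <= u t by rewrite addr_ge0.
have uC : \int[mu]_(x in `[p, q]) u x <= C.
  have -> : \int[mu]_(x in `[p, q]) u x =
      eps / 2 * \int[mu]_(x in `[p, q]) (`|g x| ^+ 2) +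
      (2 * eps)^-1 * \int[mu]_(x in `[p, q]) F (W x).
    by rewrite RintegralD// !RintegralZl.
  rewrite -lee_fin; apply: le_trans EC; rewrite /E_sMM paramsE EFinD !EFinM /Rintegral.
  by rewrite !fineK//; exact: integrable_fin_num.
have subD s t : p <= s -> t <= q -> `[s, t]%classic `<=` `[p, q]%classic.
  by move=> ps tq x /=; rewrite !in_itv/= => /andP[/(le_trans ps) -> /le_trans ->].
(* Clamping the upper limit of integration to [p, q] makes [e] monotone and bounded on the whole
   line. *)
pose cl t := Num.max p (Num.min t q).
have cl_id t : p <= t -> t <= q -> cl t = t.
  by rewrite /cl => pt tq; case: (leP t q) => [_|]; case: (leP p _); lra.
have cl_homo s t : s <= t -> cl s <= cl t.
  by move=> st; rewrite /cl ge_max !le_max lexx/= le_min !ge_min st lexx !orbT.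
have pcl t : p <= cl t by rewrite le_max lexx.
have clq t : cl t <= q by rewrite ge_max pq ge_min lexx orbT.
pose e t := \int[mu]_(x in `[p, cl t]) u x.
have eB s t : p <= s -> s <= t -> t <= q -> e t - e s = \int[mu]_(x in `[s, t]) u x.
  move=> ps st tq; rewrite /e !cl_id//; [|exact: le_trans st tq|exact: le_trans ps st].
  exact: Rintegral_primitiveB u_int ps st tq.
have e_homo s t : s <= t -> e s <= e t.
  move=> /cl_homo st; rewrite -subr_ge0 /e (Rintegral_primitiveB u_int)//.
  exact: Rintegral_ge0.
have e_ge0 t : 0 <= e t by exact: Rintegral_ge0.
have e_le t : e t <= C.
  apply: (le_trans _ uC); rewrite -subr_ge0 /e (Rintegral_primitiveB u_int)//.
  exact: Rintegral_ge0.
have sub_int (f : R -> R) s t : p <= s -> t <= q ->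
    mu.-integrable `[p, q] (EFin \o f) -> mu.-integrable `[s, t] (EFin \o f).
  by move=> ps tq; apply: integrableS => //; exact: subD.
exists e; split => //; first by move=> t; rewrite e_ge0 e_le.
- move=> m s t m0 ps st tq mF; rewrite eB//.
  apply: (@le_trans _ _ (\int[mu]_(x in `[s, t]) (Num.sqrt m * `|g x|))).
    have g_norm_int := integrable_norm (sub_int _ s t ps tq g_int).
    rewrite RintegralZl// ler_wpM2l ?sqrtr_ge0//.
    exact: H1_variation_le.
  apply: le_Rintegral => //; last 1 first.
  + move=> x /=; rewrite in_itv/= => /andP[sx xt]; have := mF x sx xt.
    rewrite -/(W x) /u /u1 /u2 => mFx.
    have sqm : Num.sqrt m ^+ 2 = m by rewrite sqr_sqrtr// ltW.
    apply: (@le_trans _ _ (eps / 2 * `|g x| ^+ 2 + (2 * eps)^-1 * m)); last first.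
      by rewrite lerD2l ler_pM2l.
    rewrite -subr_ge0 -{1}sqm; set r := Num.sqrt m; set y := `|g x|.
    (* Young's inequality by completing the square. *)
    have -> : eps / 2 * y ^+ 2 + (2 * eps)^-1 * r ^+ 2 - r * y =
        (2 * eps)^-1 * (eps * y - r) ^+ 2.
      by field; rewrite gt_eqF.
    by rewrite mulr_ge0 ?sqr_ge0// ltW.
  + have := integrableZl _ (Num.sqrt m)
      (integrable_norm (sub_int _ s t ps tq g_int)); apply => //.
  + exact: sub_int.
- move=> m s t m0 ps st tq mF; rewrite eB// -RintegralZl//; last exact: sub_int.
  have -> : m * (t - s) = \int[mu]_(x in `[s, t]) m.
    rewrite Rintegral_cst//= lebesgue_measure_itv/= lte_fin; case: ltP => //= ts.
    by have -> : t = s; [lra | rewrite subrr mulr0].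
  apply: le_Rintegral => //.
  + apply: continuous_compact_integrable; first exact: segment_compact.
    by apply: continuous_subspaceT => x; exact: cvg_cst.
  + by have := integrableZl _ (2 * eps) (sub_int _ s t ps tq u_int); apply.
  + move=> x /=; rewrite in_itv/= => /andP[sx xt]; apply: (le_trans (mF x sx xt)).
    rewrite /u mulrDr [u2 x]/u2 mulVKf ?gt_eqF ?mulr_gt0//.
    by rewrite lerDr; apply: mulr_ge0 => //; rewrite mulr_ge0// ltW.
Qed.

End energy.

(** * Graph compactness of sequences of bounded energy *)

Unset Implicit Arguments.

Theorem theorem2p2 (R : realType) (M : space1 R) (F : R -> R)
    (F_cont : continuous F)
    (F_ge0 : forall y, 0 <= F y)
    (F_eq0 : forall y, F y = 0 <-> y = 1)
    (F_coercive : exists c0 c1 : R, [/\ 0 < c0, 0 < c1 &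
       forall y, c0 * `|y| ^+ 2 - c1 <= F y])
    (eps : nat -> R)
    (eps_gt0 : forall j, 0 < eps j)
    (eps_cvg0 : eps j @[j --> \oo] --> 0)
    (v : nat -> ambient M -> R)
    (v_H1 : forall j, H1 (v j))
    (E_bounded :
       (ereal_sup [set E_sMM F (eps j) (v j) | j in [set: nat]] < +oo)%E) :
  exists sigma : nat -> nat,
    (forall m n, (m < n)%N -> (sigma m < sigma n)%N) /\
    exists Xi : ambient M -> set R,
      calA0 Xi /\ graph_cvg (fun k => v (sigma k)) Xi.
Proof.
have [c0 [c1 [c00 c10 Fc]]] := F_coercive.
have [C EC] : exists C : R, forall j, (E_sMM F (eps j) (v j) <= C%:E)%E.
  have E_le j : (E_sMM F (eps j) (v j) <=
    ereal_sup [set E_sMM F (eps j) (v j) | j in [set: nat]])%E.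
    by apply: ereal_sup_ubound; exists j.
  move: E_le E_bounded; case: ereal_sup => [C| |] E_le //; first by exists C.
  (* When the supremum is -oo, any real number is a bound. *)
  by exists 0 => j; apply: le_trans (E_le j) _; rewrite leNye.
have [e we] : exists e, forall j,
    energy_control (pmin M) (pmax M) F (eps j) C (v j \o chart M) (e j).
  have control j := H1_energy_control (eps_gt0 j) F_cont F_ge0 (v_H1 j) (EC j).
  by have [e eP] := choice control; exists e.
have well d := @well_lower_bound R F c0 c1 d F_cont F_ge0 F_eq0 c00 c10 Fc.
have [sigma [X [sigma_incr [[cX Xpq X1 Xbetween Xcount] Xcvg]]]] :=
  graph_subsequence (pmin_lt_pmax M) well eps_gt0 eps_cvg0 we.
exists sigma; split => //.
exact: (chart_graph_cvg (v := fun k => v (sigma k)) cX Xpq X1 Xbetween Xcount Xcvg).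
Qed.
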